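(* Assume the standing hypotheses on $g,h,\varphi,\psi$ given in the context, and that $\inf_{x,\lambda}\theta_\varphi(x,\lambda)>-\infty$. Let $\alpha_x\in(0,1/L_\theta)$ and let $\{(x^t,\lambda^t,y^t):t=0,1,\ldots\}$ be generated by the alternating coordinate algorithm described in the context with tolerances $\varepsilon_t>0$. Suppose there exists a constant $\rho_0>0$ such that, for every $t$, $$\|y-y_*(t)\|\le\rho_0\|G^{f,\psi}_1(x^t,y,\lambda^t)\|\qquad\text{for all } y \text{ with } \|y-y_*(t)\|\le\|y^t-y_*(t)\|.$$ Suppose also that $\|y^{t+1}-y_*(t)\|\le\|y^t-y_*(t)\|$ for $t=0,1,\ldots$ and $\sum_{t=0}^\infty\varepsilon_t^2<\infty$. Then: (i) $\displaystyle\sum_{t=0}^\infty\|(x^{t+1},\lambda^{t+1})-(x^t,\lambda^t)\|^2<\infty$; (ii) for $\sigma(x,\lambda)=\varphi(x)$, one has $G^{\theta,\sigma}_{\alpha_x^{-1}}(x^t,\lambda^t)\to0$ and $G^{f,\psi}_1(x^t,y^t,\lambda^t)\to0$ as $t\to\infty$; (iii) if $(\overline x,\overline y,\overline\lambda)$ is any accumulation point of $\{(x^t,y^t,\lambda^t)\}$, then $(\overline x,\overline y)$ is a stationary point, with Lagrange multiplier $\overline\lambda$, of the problem $\min_x\max_y\ \varphi(x)+g(x)+x^TKy-h(y)-\psi(y)$ subject to $Ax+By+c=0$.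
   Context: Data: $K\in\mathbb{R}^{n\times m}$, $A\in\mathbb{R}^{q\times n}$, $B\in\mathbb{R}^{q\times m}$, $c\in\mathbb{R}^q$; $\|\cdot\|$ is the Euclidean norm and its induced matrix norm. Standing hypotheses: $g:\mathbb{R}^n\to\mathbb{R}$ and $h:\mathbb{R}^m\to\mathbb{R}$ are convex and continuously differentiable with $\nabla g$ $L_g$-Lipschitz and $\nabla h$ $L_h$-Lipschitz, $L_g,L_h>0$; $\varphi:\mathbb{R}^n\to\mathbb{R}\cup\{+\infty\}$ and $\psi:\mathbb{R}^m\to\mathbb{R}\cup\{+\infty\}$ are proper lower semicontinuous convex; $\psi_h:=h+\psi$ is $\mu$-strongly convex, $\mu>0$. $Q(x,y,\lambda)=x^TKy-h(y)-\psi(y)+\langle\lambda,Ax+By+c\rangle$; $\theta_0(x,\lambda)=\max_yQ(x,y,\lambda)$; $y_*(x,\lambda)=\operatorname{argmax}_yQ(x,y,\lambda)$; $y_*(t)=y_*(x^t,\lambda^t)$; $\theta(x,\lambda)=g(x)+\theta_0(x,\lambda)$; $\theta_\varphi(x,\lambda)=\varphi(x)+\theta(x,\lambda)$. Under the standing hypotheses $\theta$ is continuously differentiable. $f(x,y,\lambda)=g(x)+x^TKy-h(y)+\langle\lambda,Ax+By+c\rangle$. $L_\theta=\gamma/\mu$ with $$\gamma=\max\left\{\sqrt{2(L_g\mu+\|K\|^2)^2+2(\|A\|\mu+\|K\|\|B\|)^2},\ \sqrt{2(\mu\|A\|+\|K\|\|B\|)^2+2\|B\|^4}\right\}.$$ $\mathrm{prox}_{\alpha\sigma}(z)=\operatorname{argmin}_{z'}\{\alpha\sigma(z')+\frac12\|z'-z\|^2\}$.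 For $L>0$: $G^{f,\psi}_L(x,y,\lambda)=L\big(y-\mathrm{prox}_{L^{-1}\psi}(y+L^{-1}(-\nabla h(y)+K^Tx+B^T\lambda))\big)$ (also denoted $G^{Q,\psi}_L$ in the source), and $G^{\theta,\sigma}_L(x,\lambda)=L\big((x,\lambda)-\mathrm{prox}_{L^{-1}\sigma}((x,\lambda)-L^{-1}\nabla\theta(x,\lambda))\big)$. Algorithm (alternating coordinate method). Input $(x^0,y^0,\lambda^0)\in\mathbb{R}^n\times\mathbb{R}^m\times\mathbb{R}^q$, $\alpha_x>0$, $\varepsilon_t>0$. For $t=0,1,2,\ldots$: find $y^{t+1}$ with $\|G^{f,\psi}_1(x^t,y^{t+1},\lambda^t)\|\le\varepsilon_t$; then set $$x^{t+1}=\mathrm{prox}_{\alpha_x\varphi}\big[x^t-\alpha_x(\nabla g(x^t)+Ky^{t+1}+A^T\lambda^t)\big],\qquad \lambda^{t+1}=\lambda^t-\alpha_x[Ax^t+By^{t+1}+c].$$ Stationary point with multiplier $\overline\lambda$: $0\in K\overline y+A^T\overline\lambda+\nabla g(\overline x)+\partial\varphi(\overline x)$, $0\in K^T\overline x+B^T\overline\lambda-\nabla h(\overline y)-\partial\psi(\overline y)$, $A\overline x+B\overline y+c=0$ (convex subdifferentials). *)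

(* Defs.v *)
From HB Require Import structures.
From mathcomp Require Import all_boot all_order all_algebra.
From mathcomp Require Import all_classical all_reals all_analysis.

Set Implicit Arguments.
Unset Strict Implicit.
Unset Printing Implicit Defensive.

Import Order.TTheory GRing.Theory Num.Theory.
Import numFieldNormedType.Exports.

Local Open Scope classical_set_scope.
Local Open Scope ring_scope.

(* Vectors of R^k are columns 'cV[R]_k.  The library norm `|u| on matrices is
   the max norm, hence the Euclidean norm [enorm] below; the two induce the
   same topology, so limits, continuity and differentiability are the library
   ones.  A pair (x, lambda) whose Euclidean norm, gradient or prox is needed
   is the stacked column [col_mx x lambda]. *)

Section Euclidean.
Context {R : realType}.

Definition dotv k (u v : 'cV[R]_k) : R := (u^T *m v) 0 0.

Definition enorm k (u : 'cV[R]_k) : R := Num.sqrt (dotv u u).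

Definition opnorm k l (M : 'M[R]_(k, l)) : R :=
  sup [set enorm (M *m u) | u in [set u : 'cV[R]_l | enorm u <= 1]].

Definition grad k (f : 'cV[R]_k -> R) (x : 'cV[R]_k) : 'cV[R]_k :=
  \col_i 'D_(delta_mx i 0) f x.

Definition continuously_differentiable k (f : 'cV[R]_k -> R) : Prop :=
  (forall x, differentiable f x) /\ continuous (grad f).

Definition elipschitz k l (L : R) (F : 'cV[R]_k -> 'cV[R]_l) : Prop :=
  forall u v, enorm (F u - F v) <= L * enorm (u - v).

End Euclidean.

Section ExtendedConvexAnalysis.
Context {R : realType}.
Local Open Scope ereal_scope.

Definition proper k (f : 'cV[R]_k -> \bar R) : Prop :=
  (forall x, f x != -oo) /\ (exists x, f x < +oo).

(* At t = 0, 1 the convention 0 * +oo = 0 makes these inequalities trivial. *)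
Definition econvex k (f : 'cV[R]_k -> \bar R) : Prop :=
  forall (u v : 'cV[R]_k) (t : R), (0 <= t <= 1)%R ->
    f (t *: u + (1 - t) *: v)%R <= t%:E * f u + (1 - t)%:E * f v.

Definition strongly_convex k (mu : R) (f : 'cV[R]_k -> \bar R) : Prop :=
  forall (u v : 'cV[R]_k) (t : R), (0 <= t <= 1)%R ->
    f (t *: u + (1 - t) *: v)%R
      + (mu / 2 * t * (1 - t) * enorm (u - v) ^+ 2)%:E
    <= t%:E * f u + (1 - t)%:E * f v.

Definition subdiff k (f : 'cV[R]_k -> \bar R) (x : 'cV[R]_k) : set 'cV[R]_k :=
  [set v | forall z, f x + (dotv v (z - x)%R)%:E <= f z].

(* [get] chooses an element of the set: argmin and argmax are the minimizer
   and the maximizer whenever these exist and are unique. *)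
Definition argmin (T : pointedType) (f : T -> \bar R) : T :=
  get [set p | forall z, f p <= f z].

Definition argmax (T : pointedType) (f : T -> \bar R) : T :=
  get [set p | forall z, f z <= f p].

Definition prox k (alpha : R) (sigma : 'cV[R]_k -> \bar R) (z : 'cV[R]_k)
    : 'cV[R]_k :=
  argmin (fun z' : 'cV[R]_k =>
    alpha%:E * sigma z' + (2^-1 * enorm (z' - z) ^+ 2)%:E).

End ExtendedConvexAnalysis.

Section MinimaxProblem.
Context {R : realType} {n m q : nat}.
Variables (K : 'M[R]_(n, m)) (A : 'M[R]_(q, n)) (B : 'M[R]_(q, m))
  (c : 'cV[R]_q).
Variables (g : 'cV[R]_n -> R) (h : 'cV[R]_m -> R).
Variables (phi : 'cV[R]_n -> \bar R) (psi : 'cV[R]_m -> \bar R).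

Record standing_hypotheses (Lg Lh mu : R) : Prop := StandingHypotheses {
  Lg_gt0 : 0 < Lg;
  Lh_gt0 : 0 < Lh;
  mu_gt0 : 0 < mu;
  g_convex : convex_function [set: convex_lmodType 'cV[R]_n] g;
  g_C1 : continuously_differentiable g;
  g_lip : elipschitz Lg (grad g);
  h_convex : convex_function [set: convex_lmodType 'cV[R]_m] h;
  h_C1 : continuously_differentiable h;
  h_lip : elipschitz Lh (grad h);
  phi_proper : proper phi;
  phi_lsc : lower_semicontinuous phi;
  phi_convex : econvex phi;
  psi_proper : proper psi;
  psi_lsc : lower_semicontinuous psi;
  psi_convex : econvex psi;
  psih_strongly_convex : strongly_convex mu (fun y => (h y)%:E + psi y)%E
}.

Definition Q (x : 'cV[R]_n) (y : 'cV[R]_m) (lam : 'cV[R]_q) : \bar R :=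
  ((dotv x (K *m y))%:E - (h y)%:E - psi y
    + (dotv lam (A *m x + B *m y + c))%:E)%E.

Definition theta0 (x : 'cV[R]_n) (lam : 'cV[R]_q) : \bar R :=
  ereal_sup [set Q x y lam | y in [set: 'cV[R]_m]].

Definition ystar (x : 'cV[R]_n) (lam : 'cV[R]_q) : 'cV[R]_m :=
  argmax (fun y => Q x y lam).

(* theta0 is finite under the standing hypotheses; [fine] only makes theta
   real-valued so that it has a gradient. *)
Definition theta (x : 'cV[R]_n) (lam : 'cV[R]_q) : R :=
  g x + fine (theta0 x lam).

Definition theta_phi (x : 'cV[R]_n) (lam : 'cV[R]_q) : \bar R :=
  (phi x + (theta x lam)%:E)%E.

Definition gammaconst (Lg mu : R) : R :=
  let k := opnorm K in let a := opnorm A in let b := opnorm B in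
  Num.max
    (Num.sqrt (2 * (Lg * mu + k ^+ 2) ^+ 2 + 2 * (a * mu + k * b) ^+ 2))
    (Num.sqrt (2 * (mu * a + k * b) ^+ 2 + 2 * b ^+ 4)).

Definition Ltheta (Lg mu : R) : R := gammaconst Lg mu / mu.

Definition Gf (L : R) (x : 'cV[R]_n) (y : 'cV[R]_m) (lam : 'cV[R]_q)
    : 'cV[R]_m :=
  L *: (y - prox L^-1 psi
              (y + L^-1 *: (- grad h y + K^T *m x + B^T *m lam))).

Definition Gtheta (sigma : 'cV[R]_n -> 'cV[R]_q -> \bar R) (L : R)
    (x : 'cV[R]_n) (lam : 'cV[R]_q) : 'cV[R]_(n + q) :=
  let z := col_mx x lam in
  L *: (z - prox L^-1 (fun w => sigma (usubmx w) (dsubmx w))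
              (z - L^-1 *: grad (fun w => theta (usubmx w) (dsubmx w)) z)).

Record alternating_coordinate (alpha : R) (eps : nat -> R)
    (x : nat -> 'cV[R]_n) (y : nat -> 'cV[R]_m) (lam : nat -> 'cV[R]_q)
    : Prop := AlternatingCoordinate {
  ac_y : forall t, enorm (Gf 1 (x t) (y t.+1) (lam t)) <= eps t;
  ac_x : forall t, x t.+1 =
    prox alpha phi
      (x t - alpha *: (grad g (x t) + K *m y t.+1 + A^T *m lam t));
  ac_lam : forall t,
    lam t.+1 = lam t - alpha *: (A *m x t + B *m y t.+1 + c)
}.

Definition stationary_point (x : 'cV[R]_n) (y : 'cV[R]_m) (lam : 'cV[R]_q)
    : Prop :=
  [/\ exists2 v, subdiff phi x v & 0 = K *m y + A^T *m lam + grad g x + v,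
      exists2 w, subdiff psi y w & 0 = K^T *m x + B^T *m lam - grad h y - w
    & A *m x + B *m y + c = 0].

End MinimaxProblem.

(* Main.v *)
Require Import Defs.
From HB Require Import structures.
From mathcomp Require Import all_boot all_order all_algebra.
From mathcomp Require Import all_classical all_reals all_analysis.
From mathcomp Require Import ring lra.

Set Implicit Arguments.
Unset Strict Implicit.
Unset Printing Implicit Defensive.

Import Order.TTheory GRing.Theory Num.Theory.
Import numFieldNormedType.Exports.

Local Open Scope classical_set_scope.
Local Open Scope ring_scope.

(** Write z = (x, lambda), F = h + psi and a(z) = K^T x + B^T lambda.  Up to
    terms without y, Q(x, y, lambda) is dotv (a(z)) y - F(y), so the maximizer
    p(z) = ystar z is the point where a(z) is a subgradient of the strongly
    convex F.  The strong subgradient inequality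
      F(p) + dotv a (u - p) + mu/2 |u - p|^2 <= F(u)
    carries the whole proof.

    Used at p(z) and at p(z + d), it bounds the first-order error of theta
    from both sides by multiples of |d|^2 ([theta_expansion]).  The lower bound
    and the upper bound together show that theta has the gradient
      (grad g x + K p + A^T lambda, A x + B p + c)      ([grad_theta]);
    the upper bound, after completing the square in p(z + d) - p(z), is
    Ltheta |d|^2 ([Ltheta_quadratic]).

    The algorithm is therefore a proximal gradient method for theta_phi with
    gradient error (K w, B w), where w = y^{t+1} - p(z^t), and the error bound
    hypothesis gives |w| <= rho0 eps_t.  The proximal point is itself a strong
    subgradient point, of alpha phi + |.|^2/2, and this gives the decrease
      theta_phi(z^{t+1}) + (1/alpha - Ltheta) |z^{t+1} - z^t|^2
        <= theta_phi(z^t) + (|K| |dx| + |B| |dlambda|) |w|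
    ([theta_phi_step_le]).  Young's inequality absorbs half of the decrease
    into the error term; what is left of the error is summable, and theta_phi
    is bounded below, hence (i).

    For (ii) and (iii), Gf, the fixed-point residual of the x-update and the
    constraint are Lipschitz in (x, y, lambda), because proximal maps are
    nonexpansive.  At (x^t, y^{t+1}, lambda^t) the algorithm makes them at most
    eps_t or a multiple of |z^{t+1} - z^t|; passing to
    (x^{t+1}, y^{t+1}, lambda^{t+1}) costs another multiple of |z^{t+1} - z^t|.
    So all three tend to zero along the iterates, vanish at every accumulation
    point, and their joint vanishing is stationarity
    ([stationary_of_residuals]). *)

(** * Euclidean inner product, norm and operator norm *)

Section Euclidean.
Context {R : realType}.

Lemma dotv_sumE k (u v : 'cV[R]_k) : dotv u v = \sum_i u i 0 * v i 0.
Proof. by rewrite /dotv mxE; apply: eq_bigr => i _; rewrite mxE. Qed.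

Lemma dotvC k (u v : 'cV[R]_k) : dotv u v = dotv v u.
Proof. by rewrite !dotv_sumE; apply: eq_bigr => i _; rewrite mulrC. Qed.

Lemma dotvDl k (u v w : 'cV[R]_k) : dotv (u + v) w = dotv u w + dotv v w.
Proof. by rewrite /dotv linearD mulmxDl mxE. Qed.

Lemma dotvZl k a (u w : 'cV[R]_k) : dotv (a *: u) w = a * dotv u w.
Proof. by rewrite /dotv linearZ -scalemxAl mxE. Qed.

Lemma dotvNl k (u w : 'cV[R]_k) : dotv (- u) w = - dotv u w.
Proof. by rewrite -scaleN1r dotvZl mulN1r. Qed.

Lemma dotvDr k (u v w : 'cV[R]_k) : dotv w (u + v) = dotv w u + dotv w v.
Proof. by rewrite ![dotv w _]dotvC dotvDl. Qed.

Lemma dotvZr k a (u w : 'cV[R]_k) : dotv w (a *: u) = a * dotv w u.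
Proof. by rewrite ![dotv w _]dotvC dotvZl. Qed.

Lemma dotvNr k (u w : 'cV[R]_k) : dotv w (- u) = - dotv w u.
Proof. by rewrite ![dotv w _]dotvC dotvNl. Qed.

Lemma dotvBl k (u v w : 'cV[R]_k) : dotv (u - v) w = dotv u w - dotv v w.
Proof. by rewrite dotvDl dotvNl. Qed.

Lemma dotvBr k (u v w : 'cV[R]_k) : dotv w (u - v) = dotv w u - dotv w v.
Proof. by rewrite dotvDr dotvNr. Qed.

Definition dotvE := (dotvDl, dotvDr, dotvNl, dotvNr, dotvZl, dotvZr).

Lemma dotv_trmx k l (M : 'M[R]_(l, k)) (u : 'cV[R]_l) (v : 'cV[R]_k) :
  dotv (M^T *m u) v = dotv u (M *m v).
Proof. by rewrite /dotv trmx_mul trmxK mulmxA. Qed.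

Lemma dotv_col_mx k l (u u' : 'cV[R]_k) (v v' : 'cV[R]_l) :
  dotv (col_mx u v) (col_mx u' v') = dotv u u' + dotv v v'.
Proof. by rewrite /dotv tr_col_mx mul_row_col mxE. Qed.

Lemma dotv_delta k (u : 'cV[R]_k) i : dotv u (delta_mx i 0) = u i 0.
Proof.
rewrite dotv_sumE (bigD1 i) //= big1 ?addr0 => [|j ji].
  by rewrite mxE !eqxx mulr1.
by rewrite mxE (negbTE ji) mulr0.
Qed.

Lemma dotv_ge0 k (u : 'cV[R]_k) : 0 <= dotv u u.
Proof. by rewrite dotv_sumE sumr_ge0 // => i _; rewrite -expr2 sqr_ge0. Qed.

Lemma enorm_ge0 k (u : 'cV[R]_k) : 0 <= enorm u.
Proof. exact: sqrtr_ge0. Qed.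

Lemma sqr_enorm k (u : 'cV[R]_k) : enorm u ^+ 2 = dotv u u.
Proof. by rewrite sqr_sqrtr // dotv_ge0. Qed.

Lemma enorm0 k : enorm (0 : 'cV[R]_k) = 0.
Proof. by rewrite /enorm /dotv mulmx0 mxE sqrtr0. Qed.

Lemma enormZ k a (u : 'cV[R]_k) : enorm (a *: u) = `|a| * enorm u.
Proof.
by rewrite /enorm dotvZl dotvZr mulrA -expr2 sqrtrM ?sqr_ge0 // sqrtr_sqr.
Qed.

Lemma enormN k (u : 'cV[R]_k) : enorm (- u) = enorm u.
Proof. by rewrite -scaleN1r enormZ normrN1 mul1r. Qed.

Lemma enormBC k (u v : 'cV[R]_k) : enorm (u - v) = enorm (v - u).
Proof. by rewrite -opprB enormN. Qed.

Lemma entry_le_enorm k (u : 'cV[R]_k) i : `|u i 0| <= enorm u.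
Proof.
rewrite -sqrtr_sqr ler_wsqrtr // dotv_sumE (bigD1 i) //= -expr2 lerDl.
by rewrite sumr_ge0 // => j _; rewrite -expr2 sqr_ge0.
Qed.

Lemma enorm_eq0 k (u : 'cV[R]_k) : enorm u = 0 -> u = 0.
Proof.
move=> u0; apply/matrixP => i j; rewrite ord1 mxE.
by apply/eqP; rewrite -normr_le0 -u0 entry_le_enorm.
Qed.

Lemma normr_le_enorm k (u : 'cV[R]_k) : `|u| <= enorm u.
Proof.
rewrite [leLHS]/Num.norm /= mx_normrE; apply/bigmax_leP; split => [|[i j] _ /=].
  exact: enorm_ge0.
by rewrite ord1 entry_le_enorm.
Qed.

Lemma dotv_le_enorm k (u v : 'cV[R]_k) : dotv u v <= enorm u * enorm v.
Proof.
have uv2 : dotv u v ^+ 2 <= dotv u u * dotv v v.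
  have [v0|vN0] := eqVneq (enorm v) 0.
    rewrite (enorm_eq0 v0) -(scale0r 0) !dotvZr !mul0r mulr0.
    by rewrite expr2 mul0r.
  have vv : 0 < dotv v v.
    by rewrite -sqr_enorm exprn_gt0 // lt_neqAle eq_sym vN0 enorm_ge0.
  rewrite -(ler_pM2l vv) -subr_ge0.
  have := dotv_ge0 (dotv v v *: u - dotv u v *: v).
  rewrite !dotvE (dotvC v u); lra.
apply: le_trans (ler_norm _) _.
by rewrite -sqrtr_sqr -sqrtrM ?dotv_ge0 // ler_wsqrtr.
Qed.

Lemma ler_enormD k (u v : 'cV[R]_k) : enorm (u + v) <= enorm u + enorm v.
Proof.
rewrite -(@ler_pXn2r _ 2) ?nnegrE ?addr_ge0 ?enorm_ge0 //.
rewrite sqr_enorm sqrrD !sqr_enorm !dotvE (dotvC v u).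
have := dotv_le_enorm u v; lra.
Qed.

Lemma ler_enormB k (u v : 'cV[R]_k) : enorm (u - v) <= enorm u + enorm v.
Proof. by rewrite -(enormN v) ler_enormD. Qed.

Lemma sqr_enorm_col_mx k l (u : 'cV[R]_k) (v : 'cV[R]_l) :
  enorm (col_mx u v) ^+ 2 = enorm u ^+ 2 + enorm v ^+ 2.
Proof. by rewrite !sqr_enorm dotv_col_mx. Qed.

Lemma enorm_col_mx_le k l (u : 'cV[R]_k) (v : 'cV[R]_l) :
  enorm (col_mx u v) <= enorm u + enorm v.
Proof.
rewrite -(@ler_pXn2r _ 2) ?nnegrE ?addr_ge0 ?enorm_ge0 // sqr_enorm_col_mx.
have := enorm_ge0 u; have := enorm_ge0 v; nra.
Qed.

Let opset k l (M : 'M[R]_(k, l)) :=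
  [set enorm (M *m u) | u in [set u : 'cV[R]_l | enorm u <= 1]].

(** The supremum that defines [opnorm] is over a bounded set, so it is an
    actual bound: by Cauchy-Schwarz each entry of M u is at most the norm of a
    row of M. *)
Lemma opset_ubound k l (M : 'M[R]_(k, l)) : has_ubound (opset M).
Proof.
exists (\sum_i enorm (row i M)^T) => _ [u /= u1 <-].
rewrite -(@ler_pXn2r _ 2) ?nnegrE ?enorm_ge0 ?sumr_ge0 //; last first.
  by move=> i _; exact: enorm_ge0.
set S := \sum_i _; have S0 : 0 <= S.
  by rewrite sumr_ge0 // => i _; exact: enorm_ge0.
have Mi i : `|(M *m u) i 0| <= enorm (row i M)^T.
  have -> : (M *m u) i 0 = dotv (row i M)^T u.
    by rewrite /dotv trmxK -row_mul [RHS]mxE.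
  have dle (w : 'cV[R]_l) : dotv (row i M)^T w <= enorm (row i M)^T * enorm w.
    exact: dotv_le_enorm.
  have ale (w : 'cV[R]_l) : enorm w <= 1 -> 
      dotv (row i M)^T w <= enorm (row i M)^T.
    move=> w1; apply: le_trans (dle w) _.
    by rewrite ler_piMr // enorm_ge0.
  rewrite ler_norml ale // andbT lerNl -dotvNr ale //.
  by rewrite enormN.
rewrite sqr_enorm dotv_sumE expr2 {1}/S mulr_suml; apply: ler_sum => i _.
rewrite -expr2 -[leLHS]real_normK ?num_real // expr2.
apply: ler_pM => //; apply: le_trans (Mi i) _.
rewrite /S (bigD1 i) //= lerDl sumr_ge0 // => j _; exact: enorm_ge0.
Qed.

Lemma opnorm_ge0 k l (M : 'M[R]_(k, l)) : 0 <= opnorm M.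
Proof.
apply: sup_ubound; first exact: opset_ubound.
by exists 0; rewrite /= ?enorm0 ?mulmx0 ?enorm0.
Qed.

Lemma enorm_mulmx_le k l (M : 'M[R]_(k, l)) u :
  enorm (M *m u) <= opnorm M * enorm u.
Proof.
have [u0|uN0] := eqVneq (enorm u) 0.
  by rewrite (enorm_eq0 u0) mulmx0 !enorm0 mulr0.
have u_gt0 : 0 < enorm u by rewrite lt_neqAle eq_sym uN0 enorm_ge0.
rewrite -ler_pdivrMr // mulrC -[_^-1]gtr0_norm ?invr_gt0 // -enormZ scalemxAr.
apply: sup_ubound; first exact: opset_ubound.
exists ((enorm u)^-1 *: u) => //=.
by rewrite enormZ gtr0_norm ?invr_gt0 // mulVf.
Qed.

End Euclidean.

(** * Lower semicontinuity and compactness *)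

Section LowerSemicontinuity.
Context {R : realType}.

(** The sublevel sets [F <= F v], for v in S, are nested and nonempty, so they
    generate a proper filter; lower semicontinuity places any of its cluster
    points in every one of them. *)
Lemma lsc_attains_min (T : topologicalType) (S : set T) (F : T -> \bar R) :
  compact S -> S !=set0 -> lower_semicontinuous F -> (forall u, F u != -oo)%E ->
  exists2 p, S p & forall u, S u -> (F p <= F u)%E.
Proof.
move=> cS [s0 Ss0] lscF FNy.
pose sub v := [set u | S u /\ (F u <= F v)%E].
have fil : ProperFilter (filter_from S sub).
  apply: filter_from_proper => [|v Sv]; last by exists v.
  apply: filter_from_filter; first by exists s0.
  move=> v w Sv Sw; have [vw|wv] := leP (F v) (F w).
    by exists v => // u [Su uv]; split; split => //; exact: le_trans vw.
  exists w => // u [Su uw]; split; split => //; exact: le_trans (ltW wv).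
have [|p [Sp clp]] := cS _ fil; first by exists s0 => // u [].
exists p => // v Sv; rewrite leNgt; apply/negP => vp.
have Fv : (fine (F v))%:E = F v.
  by apply: fineK; rewrite fin_numE FNy lt_eqF // (lt_le_trans vp) ?leey.
have [V pV VF] : exists2 V, nbhs p V & forall y, V y -> (F v < F y)%E.
  by rewrite -Fv; apply: lscF; rewrite Fv.
have [|u [[_ uv] Vu]] := clp (sub v) V _ pV; first by exists v.
by move: (VF u Vu); rewrite ltNge uv.
Qed.

Lemma lsc_addc (T : topologicalType) (F : T -> \bar R) (f : T -> R) :
  lower_semicontinuous F -> (forall u, F u != -oo)%E -> continuous f ->
  lower_semicontinuous (fun u => F u + (f u)%:E)%E.
Proof.
move=> lscF FNy cf x a ax.
(* b splits the gap: F stays above b near x, and f stays above a - b. *)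
have [b [xb bF]] : exists b : R, a - f x < b /\ (b%:E < F x)%E.
  move: ax (FNy x); case: (F x) => [r| |] //= ax _; last first.
    by exists (a - f x + 1); rewrite ltrDl ltr01 ltry.
  exists ((a - f x + r) / 2); rewrite lte_fin.
  by move: ax; rewrite -EFinD lte_fin => ax; split; lra.
have [V xV VF] := lscF x b bF.
exists (V `&` [set y | a - b < f y]).
  apply: filterI => //; have /cvgrPdist_lt /(_ (f x - (a - b))) := cf x.
  rewrite subr_gt0 => /(_ ltac:(lra)); apply: filterS => y /=.
  by move=> /(le_lt_trans (ler_norm _)); lra.
move=> y [/VF by_ /= ay]; move: (FNy y) by_; case: (F y) => [r| |] //= _.
  by rewrite -EFinD !lte_fin; lra.
by move=> ?; rewrite addye // ltry.
Qed.

Lemma lsc_scale (T : topologicalType) (F : T -> \bar R) (a : R) :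
  0 < a -> lower_semicontinuous F ->
  lower_semicontinuous (fun u => a%:E * F u)%E.
Proof.
move=> a0 lscF x b bx.
have scaleE y : (b%:E < a%:E * F y)%E = ((a^-1 * b)%:E < F y)%E.
  by rewrite EFinM lte_pdivrMl.
have [V xV VF] := lscF x (a^-1 * b) ltac:(by rewrite -scaleE).
by exists V => // y /VF; rewrite scaleE.
Qed.

End LowerSemicontinuity.

Section EuclideanTopology.
Context {R : realType}.

Lemma continuous_sumM (T : topologicalType) (I : Type) (s : seq I)
    (f g : I -> T -> R) : (forall i, continuous (f i)) ->
  (forall i, continuous (g i)) ->
  continuous (fun u => \sum_(i <- s) f i u * g i u).
Proof.
move=> cf cg; elim: s => [|i s IHs] u.
  by under eq_fun do rewrite big_nil; exact: cvg_cst.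
under eq_fun do rewrite big_cons.
by apply: cvgD; [apply: cvgM; [exact: cf|exact: cg]|exact: IHs].
Qed.

Lemma dotv_continuous k (a : 'cV[R]_k) : continuous (dotv a).
Proof.
rewrite (_ : dotv a = fun u => \sum_i a i 0 * u i 0); last first.
  by apply/funext => u; rewrite dotv_sumE.
refine (continuous_sumM _ _) => i.
  by move=> u; exact: cst_continuous.
exact: coord_continuous.
Qed.

Lemma sqr_enorm_continuous k : continuous (fun u : 'cV[R]_k => enorm u ^+ 2).
Proof.
rewrite (_ : (fun u => _) = fun u : 'cV[R]_k => \sum_i u i 0 * u i 0); last first.
  by apply/funext => u; rewrite sqr_enorm dotv_sumE.
by refine (continuous_sumM _ _) => i; exact: coord_continuous.
Qed.

Lemma continuous_subc (T : topologicalType) (V : normedModType R) (f : T -> V)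
  (c : V) : continuous f -> continuous (fun u => f u - c).
Proof. by move=> cf u; apply: cvgB; [exact: cf|exact: cvg_cst]. Qed.

Lemma continuous_mulc (T : topologicalType) (c : R) (f : T -> R) :
  continuous f -> continuous (fun u => c * f u).
Proof. by move=> cf u; apply: cvgM; [exact: cvg_cst|exact: cf]. Qed.

Lemma enorm_continuous k : continuous (@enorm R k).
Proof.
rewrite (_ : @enorm R k = Num.sqrt \o fun u => enorm u ^+ 2); last first.
  by apply/funext => u; rewrite /= sqrtr_sqr ger0_norm // enorm_ge0.
move=> u; apply: continuous_comp; first exact: sqr_enorm_continuous.
exact: sqrt_continuous.
Qed.

(** Heine-Borel for row vectors, carried to columns by transposition. *)
Lemma compact_eball k (c : 'cV[R]_k) r : compact [set u | enorm (u - c) <= r].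
Proof.
have tr_cont : continuous (fun v : 'rV[R]_k => v^T).
  move=> v S /= /(nbhs_ballP v^T) [e e0 eS].
  apply/nbhs_ballP; exists e => //= w [_ vw]; apply: eS.
  by split=> // i j; rewrite !mxE; exact: vw.
rewrite (_ : mkset _ = trmx @` [set v : 'rV[R]_k | enorm (v^T - c) <= r]);
  last first.
  apply/seteqP; split => [u /= ur|_ [v /= vr <-]//].
  by exists u^T; rewrite /= trmxK.
apply: continuous_compact; first exact: continuous_subspaceT.
apply: bounded_closed_compact.
  exists (r + enorm c); split; first exact: num_real.
  move=> M rM v /= vr.
  apply: (@le_trans _ _ (enorm v^T)).
    rewrite [leLHS]/Num.norm /= mx_normrE; apply/bigmax_leP.
    split=> [|[i j] _ /=]; first exact: enorm_ge0.
    by have := entry_le_enorm v^T j; rewrite mxE (ord1 i).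
  rewrite -(subrK c v^T); apply: le_trans (ler_enormD _ _) _.
  by apply: le_trans (ltW rM); rewrite lerD2r.
apply: (@closed_comp _ _ (fun v : 'rV[R]_k => enorm (v^T - c)) [set x | x <= r]).
  move=> v _; apply: (@continuous_comp _ _ _ (fun v => v^T - c) (@enorm R k)).
    exact: continuous_subc tr_cont v.
  exact: enorm_continuous.
exact: closed_le.
Qed.

End EuclideanTopology.

(** * Strongly convex functions *)

Section StrongConvexity.
Context {R : realType} {k : nat}.
Let EFin0 : 0%:E = 0%R :> \bar R. Proof. by []. Qed.
Implicit Types (F : 'cV[R]_k -> \bar R) (mu : R).

Lemma strongly_convex_real mu F u v t a b c :
  strongly_convex mu F -> 0 <= t <= 1 -> F u = a%:E -> F v = b%:E ->
  (c%:E <= F (t *: u + (1 - t) *: v)%R)%E ->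
  c + mu / 2 * t * (1 - t) * enorm (u - v) ^+ 2 <= t * a + (1 - t) * b.
Proof.
move=> scF t01 Fu Fv cF; have := scF u v t t01.
rewrite Fu Fv => /(le_trans (leeD2r _ cF)).
by rewrite -!EFinM -!EFinD lee_fin.
Qed.

(** Coercivity: F is bounded below on the unit ball around a point u0 of its
    domain, and strong convexity along the segment from u0 to u makes F(u)
    exceed F(u0) once u is far enough from u0.  The minimum over a large ball
    is then global. *)
Lemma strongly_convex_has_min mu F : 0 < mu -> Defs.proper F ->
  lower_semicontinuous F -> strongly_convex mu F ->
  exists p, forall u, (F p <= F u)%E.
Proof.
move=> mu0 [FNy [u0 Fu0y]] lscF scF.
have FE u : (F u < +oo)%E -> F u = (fine (F u))%:E.
  by move=> Fu; rewrite fineK // fin_numE FNy lt_eqF.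
set s := fine (F u0).
have Fs : F u0 = s%:E by exact: FE.
have ball0 r : 0 <= r -> enorm (u0 - u0) <= r by rewrite subrr enorm0.
have [p1 _ p1min] : exists2 p, enorm (p - u0) <= 1 &
    forall u, enorm (u - u0) <= 1 -> (F p <= F u)%E.
  apply: lsc_attains_min => //; first exact: compact_eball.
  by exists u0; exact: ball0.
have p1s : (F p1 <= s%:E)%E by rewrite -Fs; apply: p1min; exact: ball0.
have Fp1 : F p1 = (fine (F p1))%:E by apply: FE; rewrite (le_lt_trans p1s) ?ltry.
set M := fine (F p1) in Fp1.
have Ms : M <= s by rewrite -lee_fin -Fp1.
(* With r = |u - u0|, the inequality at the point of the segment that lies on
   the unit sphere reads F u >= s + r * (M - s + mu/2 * (r - 1)); r0 is the
   radius where the bracket vanishes. *)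
pose r0 := 1 + 2 * (s - M) / mu.
have r01 : 1 <= r0 by rewrite /r0 lerDl divr_ge0 ?(ltW mu0) // mulr_ge0 ?subr_ge0.
have [p _ pmin] : exists2 p, enorm (p - u0) <= r0 &
    forall u, enorm (u - u0) <= r0 -> (F p <= F u)%E.
  apply: lsc_attains_min => //; first exact: compact_eball.
  by exists u0; apply: ball0; lra.
exists p => u; have [/pmin//|ru] := leP (enorm (u - u0)) r0.
have ps : (F p <= s%:E)%E by rewrite -Fs; apply: pmin; apply: ball0; lra.
apply: le_trans ps _.
have [->|Fuy] := eqVneq (F u) +oo%E; first by rewrite leey.
rewrite FE ?ltey // lee_fin; set z := fine (F u).
set r := enorm (u - u0) in ru.
have rpos : 0 < r by lra.
have t01 : 0 <= r^-1 <= 1 by rewrite invr_ge0 ltW //= invf_le1 //; lra.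
have Mmid : (M%:E <= F (r^-1 *: u + (1 - r^-1) *: u0)%R)%E.
  rewrite -Fp1; apply: p1min.
  rewrite (_ : _ - u0 = r^-1 *: (u - u0)); last first.
    by apply/matrixP => i j; rewrite !mxE; ring.
  by rewrite enormZ gtr0_norm ?invr_gt0 // mulVf ?gt_eqF.
have Fu : F u = z%:E by apply: FE; rewrite ltey.
have := strongly_convex_real scF t01 Fu Fs Mmid.
rewrite -/r -(ler_pM2r rpos (M + _)).
have -> : (M + mu / 2 * r^-1 * (1 - r^-1) * r ^+ 2) * r
    = M * r + mu / 2 * (r - 1) * r by field; rewrite gt_eqF.
have -> : (r^-1 * z + (1 - r^-1) * s) * r = z + (r - 1) * s.
  by field; rewrite gt_eqF.
have : 2 * (s - M) / mu < r - 1 by move: ru; rewrite /r0; lra.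
rewrite ltr_pdivrMr // => H1 H2.
have : (s - M) * r <= mu / 2 * (r - 1) * r.
  by rewrite ler_pM2r //; lra.
lra.
Qed.

(** Minimality of p against the points of the segment from p to u, divided by
    the step length t, gives the growth with factor 1 - t; then t tends
    to 0. *)
Lemma strongly_convex_growth mu F p : Defs.proper F -> strongly_convex mu F ->
  (forall u, F p <= F u)%E ->
  F p \is a fin_num /\
  forall u, (F p + (mu / 2 * enorm (u - p) ^+ 2)%:E <= F u)%E.
Proof.
move=> [FNy [u0 Fu0y]] scF pmin.
have Fp : F p \is a fin_num.
  by rewrite fin_numE FNy lt_eqF // (le_lt_trans (pmin u0)).
split=> // u; have [->|Fuy] := eqVneq (F u) +oo%E; first by rewrite leey.
have Fu : F u = (fine (F u))%:E by rewrite fineK // fin_numE FNy.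
move: (Fp) => /fineK/esym Fp'.
rewrite Fp' Fu -EFinD lee_fin; set a := fine (F p); set b := fine (F u).
set w := mu / 2 * _.
have key t : 0 < t <= 1 -> w - t * w <= b - a.
  move=> /andP[t0 t1]; have t01 : 0 <= t <= 1 by rewrite ltW.
  have apmin : (a%:E <= F (t *: u + (1 - t) *: p)%R)%E by rewrite -Fp' pmin.
  have := strongly_convex_real scF t01 Fu Fp' apmin.
  rewrite -(ler_pM2l t0 (w - t * w)) -/b -/a.
  rewrite (_ : mu / 2 * t * (1 - t) * _ = t * (w - t * w)); last first.
    by rewrite /w; ring.
  lra.
rewrite leNgt; apply/negP => ba.
have w0 : 0 < `|w| + 1 by rewrite ltr_wpDl.
have d0 : 0 < w - (b - a) by lra.
(* A step so short that it loses at most half of the assumed gap. *)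
pose t := Num.min 1 ((w - (b - a)) / (2 * (`|w| + 1))).
have t0 : 0 < t by rewrite lt_min ltr01 /= divr_gt0 // mulr_gt0.
have t1 : t <= 1 by rewrite ge_min lexx.
have /key : 0 < t <= 1 by rewrite t0.
have : t * w <= (w - (b - a)) / 2.
  apply: (@le_trans _ _ (t * (`|w| + 1))).
    by rewrite ler_pM2l // ler_wpDr // ler_norm.
  apply: (@le_trans _ _ ((w - (b - a)) / (2 * (`|w| + 1)) * (`|w| + 1))).
    by rewrite ler_pM2r // ge_min lexx orbT.
  by rewrite le_eqVlt; apply/orP; left; apply/eqP; field; rewrite gt_eqF.
lra.
Qed.

(** The one closure property behind both uses of the theory: tilting F by a
    linear form (nu = 0) and adding a quadratic to a convex function (mu = 0,
    nu = 1). *)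
Lemma strongly_convex_addc mu nu c F (f : 'cV[R]_k -> R) :
  0 < c -> (forall u, F u != -oo)%E -> strongly_convex mu F ->
  (forall u v t, f (t *: u + (1 - t) *: v) + nu / 2 * t * (1 - t) *
    enorm (u - v) ^+ 2 <= t * f u + (1 - t) * f v) ->
  strongly_convex (c * mu + nu) (fun u => c%:E * F u + (f u)%:E)%E.
Proof.
move=> c0 FNy scF cf u v t t01; have := scF u v t t01; have := cf u v t.
have /andP[t0 t1] := t01.
(* The end points are apart because 0 * +oo = 0: the infinite cases below need
   both weights positive. *)
have [->|t0'] := eqVneq t 0.
  move=> _ _; rewrite !mulr0 !mul0r subr0 !mul0e !mul1e !scale0r !add0r.
  by rewrite !scale1r EFin0 adde0.
have [->|t1'] := eqVneq t 1.
  move=> _ _; rewrite subrr !mulr0 !mul0r !mul0e !mul1e !scale0r !addr0.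
  by rewrite !scale1r.
have tt0 : 0 < t by rewrite lt_neqAle eq_sym t0'.
have tt1 : 0 < 1 - t by rewrite subr_gt0 lt_neqAle t1'.
move: (FNy u) (FNy v) (FNy (t *: u + (1 - t) *: v)).
set w := t *: u + _; set e := enorm _.
have [cE tE tE'] : [/\ 0 < c%:E, 0 < t%:E & 0 < (1 - t)%:E]%E by rewrite !lte_fin.
case: (F u) => [fu| |] //; case: (F v) => [fv| |] //; case: (F w) => [fw| |] //;
  move=> _ _ _; rewrite ?(gt0_muley cE, gt0_muley tE, gt0_muley tE')
    ?(addye, addey, gt0_muley cE, gt0_muley tE, gt0_muley tE') ?leey //.
rewrite -!(EFinM, EFinD) !lee_fin => H1 H2.
have := ler_wpM2l (ltW c0) H2; lra.
Qed.

(** The point p is the minimizer of F - <a, .>; the inequality is the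
    quadratic growth of that function at its minimizer. *)
Lemma strong_subgradient_exists mu F a : 0 < mu -> Defs.proper F ->
  lower_semicontinuous F -> strongly_convex mu F ->
  exists p, F p \is a fin_num /\
    forall u, (F p + (dotv a (u - p)%R + mu / 2 * enorm (u - p)%R ^+ 2)%:E <= F u)%E.
Proof.
move=> mu0 properF lscF scF; pose G u := (F u + (dotv (- a) u)%:E)%E.
have [FNy [u0 Fu0]] := properF.
have properG : Defs.proper G.
  split=> [u|]; last by exists u0; rewrite lte_add_pinfty ?ltry.
  by have := FNy u; rewrite /G; case: (F u).
have lscG : lower_semicontinuous G.
  by apply: lsc_addc => //; exact: dotv_continuous.
have scG : strongly_convex mu G.
  have -> : mu = 1 * mu + 0 by rewrite mul1r addr0.
  rewrite (_ : G = fun u => (1%:E * F u + (dotv (- a) u)%:E)%E); last first.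
    by apply/funext => u; rewrite mul1e.
  by apply: strongly_convex_addc => // u v t; rewrite !dotvE; lra.
have [p pmin] := strongly_convex_has_min mu0 properG lscG scG.
have [Gp growth] := strongly_convex_growth properG scG pmin.
exists p; have Fp : F p \is a fin_num.
  by move: Gp; rewrite /G; case: (F p).
split=> // u; move: (growth u); rewrite /G.
case: (F p) Fp => [fp| |] // _; case: (F u) (FNy u) => [fu| |] // _;
  last by move=> _; rewrite leey.
by rewrite -!EFinD !lee_fin !dotvE; lra.
Qed.

End StrongConvexity.

(** * The proximal map *)

Section Prox.
Context {R : realType} {k : nat}.
Implicit Types (sigma : 'cV[R]_k -> \bar R) (alpha : R).

Definition prox_objective alpha sigma (z u : 'cV[R]_k) : \bar R :=
  (alpha%:E * sigma u + (2^-1 * enorm (u - z)%R ^+ 2)%:E)%E.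

(** Quadratic growth at p leaves p as the only minimizer, so the choice made in
    [prox] has to return it. *)
Lemma prox_eq alpha sigma z p :
  prox_objective alpha sigma z p \is a fin_num ->
  (forall u, prox_objective alpha sigma z p + (2^-1 * enorm (u - p)%R ^+ 2)%:E
               <= prox_objective alpha sigma z u)%E ->
  prox alpha sigma z = p.
Proof.
move=> fp growth.
have pmin u : (prox_objective alpha sigma z p <= prox_objective alpha sigma z u)%E.
  apply: le_trans (growth u); rewrite leeDl // lee_fin.
  by rewrite mulr_ge0 ?invr_ge0 ?sqr_ge0.
have pex : exists p', [set p' | forall u, prox_objective alpha sigma z p' <=
    prox_objective alpha sigma z u]%E p' by exists p.
have := growth (prox alpha sigma z).
move=> /le_trans /(_ (getPex pex p)).
rewrite -[X in (_ <= X)%E]adde0 leeD2lE // lee_fin pmulr_rle0 ?invr_gt0 //.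
by rewrite real_exprn_even_le0 ?num_real // => /eqP/enorm_eq0/subr0_eq.
Qed.

(** Expanding |u - z|^2 turns the proximal objective into F - <z, .> plus a
    constant, with F = alpha sigma + |.|^2/2 strongly convex of modulus 1: the
    proximal point is where z is a strong subgradient of F. *)
Lemma prox_growth alpha sigma z : 0 < alpha -> Defs.proper sigma ->
  lower_semicontinuous sigma -> econvex sigma ->
  let p := prox alpha sigma z in sigma p \is a fin_num /\
  forall u, (prox_objective alpha sigma z p + (2^-1 * enorm (u - p)%R ^+ 2)%:E
               <= prox_objective alpha sigma z u)%E.
Proof.
move=> alpha0 [sNy [u0 su0]] lsc_s cvx_s.
pose F u := (alpha%:E * sigma u + (2^-1 * enorm u ^+ 2)%:E)%E.
have alphaE : (0 < alpha%:E)%E by rewrite lte_fin.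
have alphasNy u : (alpha%:E * sigma u != -oo)%E.
  move: (sNy u); case: (sigma u) => [r| |] // _.
  by rewrite gt0_muley.
have FNy u : (F u != -oo)%E by move: (alphasNy u); rewrite /F; case: (_ * _)%E.
have Fpr : Defs.proper F.
  split=> //; exists u0; rewrite /F; move: (sNy u0) su0.
  by case: (sigma u0) => [r| |] // _ _; rewrite -EFinM -EFinD ltry.
have Flsc : lower_semicontinuous F.
  apply: lsc_addc => //; first exact: lsc_scale.
  by refine (continuous_mulc _); exact: sqr_enorm_continuous.
have sc0 : strongly_convex 0 sigma.
  by move=> u v t /cvx_s; rewrite !mul0r adde0; exact.
have Fsc : strongly_convex 1 F.
  have -> : 1 = alpha * 0 + 1 :> R by rewrite mulr0 add0r.
  apply: strongly_convex_addc => // u v t.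
  by rewrite !sqr_enorm !dotvE (dotvC v u); lra.
have [p [Fp Fgrowth]] := strong_subgradient_exists z (ltr01 : 0 < 1) Fpr Flsc Fsc.
have sp : sigma p \is a fin_num.
  move: Fp (sNy p); rewrite /F; case: (sigma p) => [r| |] //.
  by rewrite gt0_muley.
have growth u : (prox_objective alpha sigma z p + (2^-1 * enorm (u - p)%R ^+ 2)%:E
               <= prox_objective alpha sigma z u)%E.
  move: (Fgrowth u) (sNy u); rewrite /prox_objective /F.
  case: (sigma p) sp => [sp| |] // _; case: (sigma u) => [su| |] // + _; last first.
    by move=> _; rewrite gt0_muley // addye // leey.
  rewrite -!(EFinM, EFinD) !lee_fin !sqr_enorm !dotvE.
  by rewrite (dotvC p u) (dotvC p z) (dotvC u z); lra.
rewrite (prox_eq _ growth) //= /prox_objective.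
by case: (sigma p) sp.
Qed.

(** The term |u - p|^2/2 of the growth inequality cancels the quadratic part of
    the objective exactly, which leaves a subgradient inequality for sigma
    alone. *)
Lemma prox_subdiff alpha sigma z : 0 < alpha -> Defs.proper sigma ->
  lower_semicontinuous sigma -> econvex sigma ->
  let p := prox alpha sigma z in
  sigma p \is a fin_num /\ subdiff sigma p (alpha^-1 *: (z - p)).
Proof.
move=> alpha0 spr slsc scvx p.
have [sp growth] := prox_growth z alpha0 spr slsc scvx.
split=> // u; move: (growth u) (spr.1 u); rewrite -/p /prox_objective.
move: sp; rewrite -/p; case: (sigma p) => [sp| |] // _.
case: (sigma u) => [su| |] // + _; last by move=> _; rewrite leey.
rewrite -!(EFinM, EFinD) !lee_fin !sqr_enorm dotvZl !dotvE.
rewrite (dotvC p u) (dotvC p z) (dotvC u z) => H.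
rewrite -(ler_pM2l alpha0) mulrDr !mulrA divff ?gt_eqF // !mul1r; lra.
Qed.

Lemma subdiff_monotone sigma p p' v v' :
  sigma p \is a fin_num -> sigma p' \is a fin_num ->
  subdiff sigma p v -> subdiff sigma p' v' -> 0 <= dotv (v - v') (p - p').
Proof.
move=> fp fp' /(_ p') + /(_ p); move: fp fp'.
case: (sigma p) => [sp| |] // _; case: (sigma p') => [sp'| |] // _.
by rewrite -!EFinD !lee_fin !dotvE; lra.
Qed.

Lemma prox_nonexpansive alpha sigma z z' : 0 < alpha -> Defs.proper sigma ->
  lower_semicontinuous sigma -> econvex sigma ->
  enorm (prox alpha sigma z - prox alpha sigma z') <= enorm (z - z').
Proof.
move=> alpha0 spr slsc scvx.
have [fp sp] := prox_subdiff z alpha0 spr slsc scvx.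
have [fp' sp'] := prox_subdiff z' alpha0 spr slsc scvx.
have := subdiff_monotone fp fp' sp sp'.
set p := prox _ _ z; set p' := prox _ _ z'.
rewrite -scalerBr dotvZl pmulr_rge0 ?invr_gt0 //.
have -> : z - p - (z' - p') = (z - z') - (p - p') 
  by apply/matrixP => i j; rewrite !mxE; ring.
rewrite dotvDl dotvNl -sqr_enorm.
have := dotv_le_enorm (z - z') (p - p').
set a := enorm (p - p'); set b := enorm (z - z') => H1 H2.
have := enorm_ge0 (p - p'); rewrite -/a le_eqVlt => /predU1P[<-|a0].
  exact: enorm_ge0.
by rewrite -(ler_pM2r a0) -expr2; lra.
Qed.

End Prox.

(** The proximal objective separates, and its lambda part is minimized at the
    second component of z. *)
Lemma prox_usubmx (R : realType) n q (alpha : R) (sigma : 'cV[R]_n -> \bar R)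
    (z : 'cV[R]_(n + q)) : 0 < alpha -> Defs.proper sigma ->
  lower_semicontinuous sigma -> econvex sigma ->
  prox alpha (fun w => sigma (usubmx w)) z =
  col_mx (prox alpha sigma (usubmx z)) (dsubmx z).
Proof.
move=> alpha0 spr slsc scvx.
have [sp growth] := prox_growth (usubmx z) alpha0 spr slsc scvx.
set p := prox _ _ _ in sp growth *.
apply: prox_eq => [|u]; rewrite /prox_objective col_mxKu.
  by move: sp; case: (sigma p).
have split2 (a b : 'cV[R]_(n + q)) : enorm (a - b) ^+ 2 =
    enorm (usubmx a - usubmx b) ^+ 2 + enorm (dsubmx a - dsubmx b) ^+ 2.
  rewrite -{1}(vsubmxK a) -{1}(vsubmxK b) opp_col_mx add_col_mx.
  exact: sqr_enorm_col_mx.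
rewrite !split2 !col_mxKu !col_mxKd subrr enorm0 expr0n /= addr0.
move: (growth (usubmx u)) (spr.1 (usubmx u)); rewrite /prox_objective.
move: sp; case: (sigma p) => [r| |] // _; case: (sigma _) => [s| |] // + _.
  by rewrite -!(EFinM, EFinD) !lee_fin; lra.
by move=> _; rewrite gt0_muley ?lte_fin // addye // leey.
Qed.

(** * Gradients of real functions *)

Section Gradients.
Context {R : realType} {k : nat}.
Implicit Types (f : 'cV[R]_k -> R) (z d G : 'cV[R]_k).

Lemma derive_grad f z d : differentiable f z -> 'D_d f z = dotv (grad f z) d.
Proof.
move=> df; rewrite deriveE // dotv_sumE {1}(matrix_sum_delta d) linear_sum.
apply: eq_bigr => i _; rewrite big_ord1 linearZ /= mxE deriveE //.
by rewrite mulrC.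
Qed.

Lemma convex_gradient_le f z z' :
  convex_function [set: convex_lmodType 'cV[R]_k] f -> differentiable f z ->
  f z + dotv (grad f z) (z' - z) <= f z'.
Proof.
move=> cf df; rewrite -derive_grad //; set d := z' - z.
have dd : derivable f z d by exact: diff_derivable.
rewrite -lerBrDl /derive.
apply: (cvgr_to_le (cvg_dnbhs_at_right dd)); near=> t.
have t0 : 0 < t by near: t; exact: nbhs_right_gt.
have t1 : t <= 1 by near: t; exact: nbhs_right_le.
have := cf (Itv01 (ltW t0) t1) (z' : convex_lmodType _) (z : convex_lmodType _).
rewrite !in_setT => /(_ isT isT); rewrite convRE /conv /= => H. 
have zt : t *: d + z = t *: z' + unstable.onem t *: z.
  by apply/matrixP => i j; rewrite !mxE /unstable.onem; ring.
rewrite -[_ *: _]/(t^-1 * (f (t *: d + z) - f z)) ler_pdivrMl // zt.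
by move: H; rewrite /unstable.onem; lra.
Unshelve. all: by end_near. Qed.

(** The gradient inequality at z' replaces the integral behind the descent
    lemma.  The constant is L and not L/2; the proximal step has twice the
    decrease that the classical argument needs, so nothing is lost. *)
Lemma convex_smooth_upper f L z z' :
  convex_function [set: convex_lmodType 'cV[R]_k] f ->
  (forall x, differentiable f x) -> elipschitz L (grad f) ->
  f z' <= f z + dotv (grad f z) (z' - z) + L * enorm (z' - z) ^+ 2.
Proof.
move=> cf df lf; have := convex_gradient_le z cf (df z').
have := dotv_le_enorm (grad f z' - grad f z) (z' - z).
have := lf z' z; have := enorm_ge0 (z' - z).
set e := enorm (z' - z); set e' := enorm (_ - _) => e0 lip.
have : e' * e <= L * e ^+ 2 by rewrite expr2 mulrA ler_wpM2r.
by rewrite !dotvE; lra.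
Qed.

(** [grad] is made of directional derivatives along the axes, so a first-order
    expansion with quadratic error along every line determines it. *)
Lemma grad_of_quadratic_error f z G C :
  (forall d, `|f (z + d) - f z - dotv G d| <= C * enorm d ^+ 2) -> grad f z = G.
Proof.
move=> fG; apply/matrixP => i j; rewrite ord1 mxE.
set v := delta_mx i 0; have <- : dotv G v = G i 0 by exact: dotv_delta.
rewrite /derive; apply: cvg_lim => //.
apply/cvgrPdist_le => e e0.
have D0 : 0 < `|C| * enorm v ^+ 2 + 1.
  by rewrite ltr_wpDl // mulr_ge0 ?sqr_ge0.
have eD : 0 < e / (`|C| * enorm v ^+ 2 + 1) by exact: divr_gt0.
near=> t.
have tN0 : t != 0 by near: t; exact: nbhs_dnbhs_neq.
have te : `|t| * (`|C| * enorm v ^+ 2 + 1) <= e.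
  rewrite -ler_pdivlMr //; near: t; exact: dnbhs0_le.
have := fG (t *: v); rewrite dotvZr enormZ /= => H.
have -> : dotv G v - t^-1 * (f (t *: v + z) - f z) =
    - t^-1 * (f (z + t *: v) - f z - t * dotv G v).
  by rewrite (addrC z); field.
rewrite normrM normrN normfV ler_pdivrMl ?normr_gt0 //.
apply: le_trans H _; rewrite exprMn real_normK ?num_real //.
apply: le_trans (_ : `|t| * (`|t| * (`|C| * enorm v ^+ 2 + 1)) <= _); last first.
  by rewrite ler_wpM2l.
rewrite mulrA -expr2 real_normK ?num_real //.
have := ler_wpM2r (mulr_ge0 (sqr_ge0 t) (sqr_ge0 (enorm v))) (ler_norm C).
have := sqr_ge0 t; lra.
Unshelve. all: by end_near. Qed.

End Gradients.

(** * The value function theta and its first-order expansion *)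

Section ValueFunction.
Context {R : realType} {n m q : nat}.
Context (K : 'M[R]_(n, m)) (A : 'M[R]_(q, n)) (B : 'M[R]_(q, m)) (c : 'cV[R]_q).
Context (g : 'cV[R]_n -> R) (h : 'cV[R]_m -> R).
Context (phi : 'cV[R]_n -> \bar R) (psi : 'cV[R]_m -> \bar R).
Context (Lg Lh mu : R) (Hst : standing_hypotheses g h phi psi Lg Lh mu).
Implicit Types (x : 'cV[R]_n) (y : 'cV[R]_m) (lam : 'cV[R]_q).

Let psih y : \bar R := ((h y)%:E + psi y)%E.

Let slope x lam : 'cV[R]_m := K^T *m x + B^T *m lam.

Let psihNy y : (psih y != -oo)%E.
Proof. by move: ((psi_proper Hst).1 y); rewrite /psih; case: (psi y). Qed.

Let Q_slope x y lam : Q K A B c h psi x y lam =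
  ((dotv (slope x lam) y + dotv lam (A *m x + c))%:E - psih y)%E.
Proof.
rewrite /Q /psih /slope !dotvE !dotv_trmx addrC.
move: ((psi_proper Hst).1 y); case: (psi y) => [r| |] // _.
by rewrite -!(EFinM, EFinD, EFinN); congr EFin; ring.
Qed.

Local Notation ys := (ystar K A B c h psi).

(** Q(x, ., lambda) is a constant plus <slope, .> - (h + psi): its maximizer is
    the point where the slope is a strong subgradient of h + psi. *)
Lemma ystar_strong_subgradient x lam :
  psih (ys x lam) \is a fin_num /\ forall y,
  (psih (ys x lam) + (dotv (slope x lam) (y - ys x lam)%R
     + mu / 2 * enorm (y - ys x lam)%R ^+ 2)%:E <= psih y)%E.
Proof.
have [psiNy [y0 psiy0]] := psi_proper Hst.
have psihpr : Defs.proper psih.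
  by split=> //; exists y0; rewrite /psih lte_add_pinfty ?ltry.
have psihlsc : lower_semicontinuous psih.
  rewrite (_ : psih = fun y => (psi y + (h y)%:E)%E); last first.
    by apply/funext => y; rewrite /psih addeC.
  apply: lsc_addc => //; first exact: psi_lsc Hst.
  by move=> y; apply: differentiable_continuous; have [+ _] := h_C1 Hst; apply.
have [p [psip growth]] := strong_subgradient_exists (slope x lam) (mu_gt0 Hst)
  psihpr psihlsc (psih_strongly_convex Hst).
have pmax y : (Q K A B c h psi x y lam <= Q K A B c h psi x p lam)%E.
  rewrite !Q_slope; move: (growth y) (psihNy y); case: (psih p) psip => [sp| |] // _.
  case: (psih y) => [s| |] // + _; rewrite ?leNye // -!(EFinN, EFinD) !lee_fin.
  have := mulr_ge0 (divr_ge0 (ltW (mu_gt0 Hst)) (ler0n _ 2)) (sqr_ge0 (enorm (y - p))).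
  by rewrite !dotvE; lra.
have pex : exists y, [set y | forall z, Q K A B c h psi x z lam <=
    Q K A B c h psi x y lam]%E y by exists p.
suff -> : ys x lam = p by [].
have := getPex pex p; rewrite -[get _]/(ys x lam) !Q_slope.
move: (growth (ys x lam)) (psihNy (ys x lam)).
case: (psih p) psip => [sp| |] // _; case: (psih _) => [s| |] // + _.
rewrite -!(EFinN, EFinD) !lee_fin => H1 H2.
have : mu / 2 * enorm (ys x lam - p) ^+ 2 <= 0 by move: H1 H2; rewrite !dotvE; lra.
rewrite pmulr_rle0 ?divr_gt0 ?(mu_gt0 Hst) //.
by rewrite real_exprn_even_le0 ?num_real // => /eqP/enorm_eq0/subr0_eq.
Qed.

Let Psi x lam := fine (psih (ys x lam)).

Let PsiE x lam : psih (ys x lam) = (Psi x lam)%:E.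
Proof. by rewrite fineK //; have [] := ystar_strong_subgradient x lam. Qed.

Let Psi_growth x lam x' lam' :
  Psi x lam + dotv (slope x lam) (ys x' lam' - ys x lam)
    + mu / 2 * enorm (ys x' lam' - ys x lam) ^+ 2 <= Psi x' lam'.
Proof.
have [_ /(_ (ys x' lam'))] := ystar_strong_subgradient x lam.
by rewrite !PsiE -EFinD lee_fin addrA.
Qed.

Let theta0E x lam : fine (theta0 K A B c h psi x lam) =
  dotv (slope x lam) (ys x lam) + dotv lam (A *m x + c) - Psi x lam.
Proof.
suff -> : theta0 K A B c h psi x lam = Q K A B c h psi x (ys x lam) lam.
  by rewrite Q_slope PsiE.
apply/eqP; rewrite eq_le; apply/andP; split; last first.
  by apply: ereal_sup_ubound; exists (ys x lam).
apply: ge_ereal_sup => _ [y _ <-]; rewrite !Q_slope PsiE.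
have [_ /(_ y)] := ystar_strong_subgradient x lam; rewrite PsiE.
move: (psihNy y); case: (psih y) => [s| |] // _; rewrite ?leNye //.
rewrite -!(EFinN, EFinD) !lee_fin.
have := mulr_ge0 (divr_ge0 (ltW (mu_gt0 Hst)) (ler0n _ 2)) (sqr_ge0 (enorm (y - ys x lam))).
by rewrite !dotvE; lra.
Qed.

(** Danskin's formula: the partial gradient in (x, lambda) of the function under
    the maximum, taken at the maximizer. *)
Definition theta_grad x lam : 'cV[R]_(n + q) :=
  col_mx (grad g x + K *m ys x lam + A^T *m lam) (A *m x + B *m ys x lam + c).

Local Notation th := (theta K A B c g h psi).

Let coupling x lam dx dl :
  dotv (lam + dl) (A *m (x + dx) + c) - dotv lam (A *m x + c) =
  dotv lam (A *m dx) + dotv dl (A *m x + c) + dotv dl (A *m dx).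
Proof.
rewrite mulmxDr addrAC dotvDl !(dotvDr (A *m x + c)); ring.
Qed.

Let theta_grad_dot x lam dx dl :
  dotv (theta_grad x lam) (col_mx dx dl) =
    dotv (grad g x) dx + dotv dx (K *m ys x lam) + dotv dl (B *m ys x lam)
    + dotv lam (A *m dx) + dotv dl (A *m x + c).
Proof.
rewrite /theta_grad dotv_col_mx; move: (ys x lam) (grad g x) => p gx.
rewrite (addrAC (A *m x)) (dotvC _ dl) (dotvDr (A *m x + c)).
rewrite 2!dotvDl (dotv_trmx A) (dotvC (K *m p)); ring.
Qed.

Let slope_shift x lam dx dl y : dotv (slope (x + dx) (lam + dl)) y =
  dotv (slope x lam) y + dotv dx (K *m y) + dotv dl (B *m y).
Proof.
rewrite -(dotv_trmx K) -(dotv_trmx B) -!dotvDl; congr dotv.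
by rewrite /slope !mulmxDr addrACA !addrA.
Qed.

(** Lower bound: the old maximizer competes at the new point, and the gradient
    inequality for g.  Upper bound: the strong subgradient inequality at the
    old point, tested at the new maximizer, and the smoothness of g.  The term
    dotv dl (A *m dx) is the second-order part of the bilinear coupling. *)
Lemma theta_expansion x lam dx dl :
  let e := ys (x + dx) (lam + dl) - ys x lam in
  let D := th (x + dx) (lam + dl) - th x lam
           - dotv (theta_grad x lam) (col_mx dx dl) in
  dotv dl (A *m dx) <= D /\
  D <= Lg * enorm dx ^+ 2 + dotv dx (K *m e) + dotv dl (B *m e)
       + dotv dl (A *m dx) - mu / 2 * enorm e ^+ 2.
Proof.
move=> e D; rewrite {}/D /theta !theta0E theta_grad_dot {}/e.
have := convex_gradient_le (x + dx) (g_convex Hst) ((g_C1 Hst).1 x).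
have := convex_smooth_upper x (x + dx) (g_convex Hst) (g_C1 Hst).1 (g_lip Hst).
rewrite (addrC x) addrK (addrC dx).
have := Psi_growth x lam (x + dx) (lam + dl).
have := Psi_growth (x + dx) (lam + dl) x lam.
have := coupling x lam dx dl.
have mu0 := mu_gt0 Hst.
move: (Psi x lam) (Psi (x + dx) (lam + dl)) => s s'.
move: (ys x lam) (ys (x + dx) (lam + dl)) => p p'.
rewrite !slope_shift (enormBC p p') !mulmxBr !dotvBr.
have := mulr_ge0 (ltW mu0) (sqr_ge0 (enorm (p' - p))).
move: (enorm _ ^+ 2) (enorm dx ^+ 2) (g x) (g (x + dx)) => e2 d2 g0 g1.
move: (dotv dx (K *m p)) (dotv dx (K *m p')) => k0 k1.
move: (dotv dl (B *m p)) (dotv dl (B *m p')) => b0 b1.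
move: (dotv (slope x lam) p) (dotv (slope x lam) p') => a0 a1.
move: (dotv (lam + dl) _) (dotv lam (A *m x + c)) => c0 c1.
move: (dotv lam (A *m dx)) (dotv dl (A *m x + c)) (dotv dl (A *m dx)) => u v w.
move: (dotv (grad g x) dx) => gd; move: mu Lg; clear => mu Lg *.
split; lra.
Qed.

End ValueFunction.

(** * The constant Ltheta *)

Section DescentConstant.
Context {R : realType} {n m q : nat}.
Context (K : 'M[R]_(n, m)) (A : 'M[R]_(q, n)) (B : 'M[R]_(q, m)).

Lemma Ltheta_ge0 Lg mu : 0 < mu -> 0 <= Ltheta K A B Lg mu.
Proof.
move=> mu0; rewrite /Ltheta divr_ge0 ?(ltW mu0) // /gammaconst le_max.
by rewrite sqrtr_ge0.
Qed.

(** Here u = |dx|, v = |dlambda| and w is the displacement of the maximizer.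
    Completing the square in w leaves a quadratic form in (u, v) whose
    coefficients, times mu, are dominated by those of the matrix with rows
    (P, S) and (S, |B|^2), where P = Lg mu + |K|^2 and S = |A| mu + |K| |B|;
    the square roots in [gammaconst] dominate both row sums, since
    s + t <= sqrt (2 s^2 + 2 t^2). *)
Lemma Ltheta_quadratic Lg mu u v w : 0 < Lg -> 0 < mu -> 0 <= u -> 0 <= v ->
  Lg * u ^+ 2 + opnorm K * u * w + opnorm B * v * w + opnorm A * u * v
    - mu / 2 * w ^+ 2 <= Ltheta K A B Lg mu * (u ^+ 2 + v ^+ 2).
Proof.
move=> Lg0 mu0 u0 v0; rewrite /Ltheta /gammaconst.
have := opnorm_ge0 K; have := opnorm_ge0 A; have := opnorm_ge0 B.
move: (opnorm K) (opnorm A) (opnorm B) => k a b b0 a0 k0.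
set P := Lg * mu + k ^+ 2; set S := a * mu + k * b.
set gam := Num.max _ _.
have P0 : 0 <= P by rewrite addr_ge0 ?mulr_ge0 ?sqr_ge0 // ltW.
have S0 : 0 <= S by rewrite addr_ge0 ?mulr_ge0 // ltW.
have sum_le_sqrt (s t : R) : 0 <= s -> 0 <= t ->
    s + t <= Num.sqrt (2 * s ^+ 2 + 2 * t ^+ 2).
  move=> s0 t0; rewrite -[leLHS]ger0_norm ?addr_ge0 // -sqrtr_sqr ler_wsqrtr //.
  have := sqr_ge0 (s - t); lra.
have gamPS : P + S <= gam.
  by rewrite /gam le_max sum_le_sqrt.
have gamSD : S + b ^+ 2 <= gam.
  rewrite /gam le_max; apply/orP; right.
  have -> : 2 * (mu * a + k * b) ^+ 2 + 2 * b ^+ 4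
      = 2 * S ^+ 2 + 2 * (b ^+ 2) ^+ 2 by rewrite /S; ring.
  by rewrite sum_le_sqrt // sqr_ge0.
rewrite [leRHS]mulrAC ler_pdivlMr //.
have := sqr_ge0 (k * u + b * v - mu * w).
have := ler_wpM2r (sqr_ge0 u) gamPS; have := ler_wpM2r (sqr_ge0 v) gamSD.
have := mulr_ge0 S0 (sqr_ge0 (u - v)).
have := mulr_ge0 S0 (sqr_ge0 u); have := mulr_ge0 S0 (sqr_ge0 v).
have := sqr_ge0 (k * u); have := sqr_ge0 (b * v).
clearbody gam; rewrite /P /S; clear; lra.
Qed.

End DescentConstant.

Section ValueFunctionDescent.
Context {R : realType} {n m q : nat}.
Context (K : 'M[R]_(n, m)) (A : 'M[R]_(q, n)) (B : 'M[R]_(q, m)) (c : 'cV[R]_q).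
Context (g : 'cV[R]_n -> R) (h : 'cV[R]_m -> R).
Context (phi : 'cV[R]_n -> \bar R) (psi : 'cV[R]_m -> \bar R).
Context (Lg Lh mu : R) (Hst : standing_hypotheses g h phi psi Lg Lh mu).
Implicit Types (x : 'cV[R]_n) (y : 'cV[R]_m) (lam : 'cV[R]_q).

Local Notation ys := (ystar K A B c h psi).
Local Notation th := (theta K A B c g h psi).
Local Notation L := (Ltheta K A B Lg mu).

Let dotv_mulmx_le k l (M : 'M[R]_(k, l)) (u : 'cV[R]_k) (v : 'cV[R]_l) :
  dotv u (M *m v) <= opnorm M * enorm u * enorm v.
Proof.
apply: le_trans (dotv_le_enorm _ _) _.
by rewrite (mulrC (opnorm M)) -mulrA ler_wpM2l ?enorm_ge0 ?enorm_mulmx_le.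
Qed.

(** The coefficient is Ltheta itself, twice what a descent lemma would give,
    because the bound for g is [convex_smooth_upper]. *)
Lemma theta_upper x lam dx dl :
  th (x + dx) (lam + dl) - th x lam
    - dotv (theta_grad K A B c g h psi x lam) (col_mx dx dl)
  <= L * (enorm dx ^+ 2 + enorm dl ^+ 2).
Proof.
have [_ up] := theta_expansion K A B c Hst x lam dx dl.
apply: le_trans up _; set e := _ - ys x lam.
apply: le_trans (Ltheta_quadratic K A B (enorm e) (Lg_gt0 Hst) (mu_gt0 Hst)
  (enorm_ge0 dx) (enorm_ge0 dl)).
have := dotv_mulmx_le K dx e; have := dotv_mulmx_le B dl e.
have := dotv_mulmx_le A dl dx.
move: (dotv dx _) (dotv dl (B *m e)) (dotv dl _) (enorm e) (enorm dx) (enorm dl).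
move: (opnorm _) (opnorm _) (opnorm _) => *; lra.
Qed.

Lemma theta_lower x lam dx dl :
  - (opnorm A * (enorm dx ^+ 2 + enorm dl ^+ 2)) <=
  th (x + dx) (lam + dl) - th x lam
    - dotv (theta_grad K A B c g h psi x lam) (col_mx dx dl).
Proof.
have [low _] := theta_expansion K A B c Hst x lam dx dl.
apply: le_trans low; rewrite lerNl -dotvNr -mulmxN.
apply: le_trans (dotv_mulmx_le _ _ _) _; rewrite enormN -mulrA.
apply: ler_wpM2l; first exact: opnorm_ge0.
move: (enorm dx) (enorm dl) => u v.
have := sqr_ge0 u; have := sqr_ge0 v; have := sqr_ge0 (u - v); lra.
Qed.

Lemma grad_theta x lam :
  grad (fun w => th (usubmx w) (dsubmx w)) (col_mx x lam) =
  theta_grad K A B c g h psi x lam.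
Proof.
apply: (@grad_of_quadratic_error _ _ _ _ _ (L + opnorm A)) => d.
rewrite -(vsubmxK d); set dx := usubmx d; set dl := dsubmx d.
rewrite add_col_mx !col_mxKu !col_mxKd sqr_enorm_col_mx.
have := theta_upper x lam dx dl; have := theta_lower x lam dx dl.
have := mulr_ge0 (Ltheta_ge0 K A B Lg (mu_gt0 Hst))
  (addr_ge0 (sqr_ge0 (enorm dx)) (sqr_ge0 (enorm dl))).
have := mulr_ge0 (opnorm_ge0 A)
  (addr_ge0 (sqr_ge0 (enorm dx)) (sqr_ge0 (enorm dl))).
rewrite mulrDl ler_norml; move: (_ - _ - _) (L * _) (opnorm A * _) => D a b.
by move=> *; apply/andP; split; lra.
Qed.

End ValueFunctionDescent.

(** * Sequences and accumulation points *)

Section Sequences.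
Context {R : realType}.
Implicit Types (u : R ^nat).

Lemma nneseries_ltyP u : (forall t, 0 <= u t) ->
  (\sum_(0 <= t <oo) (u t)%:E < +oo)%E <->
  exists M, forall N, \sum_(0 <= t < N) u t <= M.
Proof.
move=> u0; have u0E t : (0 <= (u t)%:E)%E by rewrite lee_fin.
split=> [ulty|[M uM]].
  exists (fine (\sum_(0 <= t <oo) (u t)%:E)%E) => N.
  rewrite -lee_fin fineK; last first.
    by rewrite ge0_fin_numE // nneseries_ge0.
  by rewrite -sumEFin; apply: nneseries_lim_ge => *; exact: u0E.
apply: (@le_lt_trans _ _ M%:E); last exact: ltry.
apply: lime_le; first by apply: is_cvg_nneseries => *; exact: u0E.
by apply: nearW => N; rewrite sumEFin lee_fin.
Qed.

Lemma summable_cvg0 u : (forall t, 0 <= u t) ->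
  (\sum_(0 <= t <oo) (u t)%:E < +oo)%E -> u @ \oo --> 0.
Proof.
move=> u0 /(nneseries_ltyP u0)[M uM]; apply: cvg_series_cvg_0.
apply: nondecreasing_is_cvgn; last by exists M => _ [N _ <-]; exact: uM.
apply/nondecreasing_seqP => N.
by rewrite /series /= big_nat_recr //= lerDl.
Qed.

Lemma sqr_cvg0 u : (forall t, 0 <= u t) -> (u t ^+ 2 @[t --> \oo] --> 0) ->
  u @ \oo --> 0.
Proof.
move=> u0 u2; rewrite (_ : u = (fun t => Num.sqrt (u t ^+ 2))); last first.
  by apply/funext => t; rewrite sqrtr_sqr ger0_norm.
rewrite -[X in _ --> X]sqrtr0.
by apply: continuous_cvg => //; exact: sqrt_continuous.
Qed.

(** The descent starts at index 1: the starting point x^0 may lie outside the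
    domain of phi, whereas every later iterate is a proximal point. *)
Lemma summable_of_descent (V s e : R ^nat) (C b : R) : 0 < C ->
  (forall t, 0 <= s t) -> (forall t, 0 <= e t) -> (forall t, b <= V t.+1) ->
  (forall t, V t.+2 + C * s t.+1 <= V t.+1 + e t.+1) ->
  (\sum_(0 <= t <oo) (e t)%:E < +oo)%E -> (\sum_(0 <= t <oo) (s t)%:E < +oo)%E.
Proof.
move=> C0 s0 e0 Vb step /(nneseries_ltyP e0)[M eM].
apply/(nneseries_ltyP s0); exists (s 0%N + (V 1%N - b + M) / C) => N.
have telescope N' : V N'.+1 + C * \sum_(1 <= t < N'.+1) s t
    <= V 1%N + \sum_(1 <= t < N'.+1) e t.
  elim: N' => [|N' IH]; first by rewrite !big_geq // mulr0.
  by rewrite !(big_nat_recr N'.+1) //= mulrDr; have := step N'; lra.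
apply: (@le_trans _ _ (\sum_(0 <= t < N.+1) s t)).
  by rewrite big_nat_recr //= lerDl.
rewrite big_ltn // lerD2l ler_pdivlMr // mulrC.
have := telescope N; have := Vb N; have := eM N.+1; have := e0 0%N.
rewrite [\sum_(0 <= t < N.+1) e t]big_ltn //; lra.
Qed.

Lemma cvg_enorm0 k (u : nat -> 'cV[R]_k) (v : R ^nat) :
  (forall t, enorm (u t) <= v t) -> v @ \oo --> 0 -> u @ \oo --> (0 : 'cV[R]_k).
Proof.
move=> uv v0; apply/cvgr0Pnorm_le => e e0.
have /cvgr0Pnorm_le/(_ e e0) := v0; apply: filterS => t; apply: le_trans.
apply: le_trans (normr_le_enorm _) _; apply: le_trans (uv t) _; exact: ler_norm.
Qed.

Lemma nbhs_enorm k (u : 'cV[R]_k) (e : R) :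
  0 < e -> nbhs u [set v | enorm (v - u) < e].
Proof.
move=> e0.
have idc : continuous (id : 'cV[R]_k -> 'cV[R]_k) by move=> v; exact: cvg_id.
have c : continuous (fun v : 'cV[R]_k => enorm (v - u)) := fun v =>
  @continuous_comp 'cV[R]_k 'cV[R]_k R (fun v => v - u) (@enorm R k) v
    (@continuous_subc R 'cV[R]_k 'cV[R]_k id u idc v) (@enorm_continuous R k (v - u)).
have o : open [set v : 'cV[R]_k | enorm (v - u) < e].
  by apply: (open_comp (f := fun v : 'cV[R]_k => enorm (v - u))
    (D := [set r | r < e])) => [v _|]; [exact: c|exact: open_lt].
by apply: open_nbhs_nbhs; split=> //=; rewrite subrr enorm0.
Qed.

Definition jointly_lipschitz n m q k (C : R)
    (F : 'cV[R]_n -> 'cV[R]_m -> 'cV[R]_q -> 'cV[R]_k) :=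
  forall x y l x' y' l', enorm (F x y l - F x' y' l') <=
    C * (enorm (x - x') + enorm (y - y') + enorm (l - l')).

(** The algorithm controls its residuals at the mixed points
    (x^t, y^{t+1}, lambda^t); when the x and lambda steps vanish, the control
    passes to (x^{t+1}, y^{t+1}, lambda^{t+1}). *)
Lemma residual_cvg0 n m q k (x : nat -> 'cV[R]_n) (y : nat -> 'cV[R]_m)
    (lam : nat -> 'cV[R]_q) C
    (F : 'cV[R]_n -> 'cV[R]_m -> 'cV[R]_q -> 'cV[R]_k) :
  jointly_lipschitz C F ->
  enorm (x t.+1 - x t) @[t --> \oo] --> 0 ->
  enorm (lam t.+1 - lam t) @[t --> \oo] --> 0 ->
  enorm (F (x t) (y t.+1) (lam t)) @[t --> \oo] --> 0 ->
  enorm (F (x t) (y t) (lam t)) @[t --> \oo] --> 0.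
Proof.
move=> lipF x0 l0 F0; rewrite -cvg_shiftS.
have up : C * (enorm (x t.+1 - x t) + enorm (lam t.+1 - lam t)) +
    enorm (F (x t) (y t.+1) (lam t)) @[t --> \oo] --> 0.
  rewrite -[X in _ --> X]addr0 -[X in _ --> X + _](mulr0 C).
  apply: cvgD => //; apply: cvgMr; rewrite -[X in _ --> X]addr0; exact: cvgD.
apply: squeeze_cvgr (cvg_cst 0) up; apply: nearW => t.
rewrite enorm_ge0 /=; rewrite -[X in enorm X](subrK (F (x t) (y t.+1) (lam t))).
apply: le_trans (ler_enormD _ _) _; rewrite lerD2r.
by apply: le_trans (lipF _ _ _ _ _ _) _; rewrite subrr enorm0 addr0.
Qed.

Lemma cluster_zero n m q k (x : nat -> 'cV[R]_n) (y : nat -> 'cV[R]_m)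
    (lam : nat -> 'cV[R]_q) xb yb lamb C
    (F : 'cV[R]_n -> 'cV[R]_m -> 'cV[R]_q -> 'cV[R]_k) :
  jointly_lipschitz C F ->
  enorm (F (x t) (y t) (lam t)) @[t --> \oo] --> 0 ->
  cluster ((fun t => (x t, y t, lam t)) @ \oo) (xb, yb, lamb) ->
  F xb yb lamb = 0.
Proof.
move=> lipF r0 clu; apply: enorm_eq0; apply/eqP; rewrite eq_le enorm_ge0 andbT.
apply/ler_addgt0Pr => e e0; rewrite add0r.
have C0 : 0 < `|C| + 1 by rewrite ltr_wpDl.
pose d := e / 2 / 3 / (`|C| + 1); have d0 : 0 < d by rewrite !divr_gt0.
have e2 : 0 < e / 2 by rewrite divr_gt0.
have /cvgr0Pnorm_le/(_ _ e2) rle := r0.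
pose U : set ('cV[R]_n * 'cV[R]_m * 'cV[R]_q) := [set p | [/\ enorm (p.1.1 - xb) < d,
  enorm (p.1.2 - yb) < d & enorm (p.2 - lamb) < d]].
have nU : nbhs (xb, yb, lamb) U.
  exists ([set p | enorm (p.1 - xb) < d /\ enorm (p.2 - yb) < d],
    [set v | enorm (v - lamb) < d]); last first.
    by move=> [[u v] w] [/= [? ?] ?].
  split => /=; last exact: nbhs_enorm.
  exists ([set v | enorm (v - xb) < d], [set v | enorm (v - yb) < d]).
    by split; exact: nbhs_enorm.
  by move=> [u v] [].
pose r t := enorm (F (x t) (y t) (lam t)).
pose T := [set (x t, y t, lam t) | t in [set t | `|r t| <= e / 2]].
have [|[[u v] w] [[t /= rt [<- <- <-]] [/= xd yd ld]]] := clu T U _ nU.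
  by apply: filterS rle => t rt; exists t.
rewrite -(subrK (F (x t) (y t) (lam t)) (F xb yb lamb)).
apply: le_trans (ler_enormD _ _) _.
have Fe : enorm (F (x t) (y t) (lam t)) <= e / 2 := le_trans (ler_norm _) rt.
have := lipF xb yb lamb (x t) (y t) (lam t).
rewrite (enormBC xb) (enormBC yb) (enormBC lamb).
set S := _ + _ + _ => lip.
have : C * S <= e / 2.
  apply: (@le_trans _ _ ((`|C| + 1) * (3 * d))); last first.
    by rewrite le_eqVlt; apply/orP; left; apply/eqP; rewrite /d; field; rewrite gt_eqF.
  apply: (@le_trans _ _ ((`|C| + 1) * S)).
    rewrite ler_wpM2r ?addr_ge0 ?enorm_ge0 //.
    by apply: le_trans (ler_norm C) _; rewrite lerDl.
  by rewrite ler_wpM2l ?(ltW C0) // /S; lra.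
lra.
Qed.

End Sequences.

(** * One step of the algorithm *)

Lemma subr_swap (V : zmodType) (a b d e : V) :
  a - b - (d - e) = (a - d) - (b - e).
Proof. by rewrite !opprB addrACA [in RHS]addrACA (addrC (- b)). Qed.

Section OneStep.
Context {R : realType} {n m q : nat}.
Context (K : 'M[R]_(n, m)) (A : 'M[R]_(q, n)) (B : 'M[R]_(q, m)) (c : 'cV[R]_q).
Context (g : 'cV[R]_n -> R) (h : 'cV[R]_m -> R).
Context (phi : 'cV[R]_n -> \bar R) (psi : 'cV[R]_m -> \bar R).
Context (Lg Lh mu : R) (Hst : standing_hypotheses g h phi psi Lg Lh mu).
Context (alpha : R) (alpha0 : 0 < alpha).
Implicit Types (x : 'cV[R]_n) (y : 'cV[R]_m) (lam : 'cV[R]_q).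

Local Notation ys := (ystar K A B c h psi).
Local Notation th := (theta K A B c g h psi).

Definition x_step x y lam :=
  prox alpha phi (x - alpha *: (grad g x + K *m y + A^T *m lam)).

Definition lam_step x y lam := lam - alpha *: (A *m x + B *m y + c).

Let theta_grad_shift x lam y : theta_grad K A B c g h psi x lam =
  col_mx (grad g x + K *m y + A^T *m lam - K *m (y - ys x lam))
         (A *m x + B *m y + c - B *m (y - ys x lam)).
Proof.
rewrite /theta_grad; move: (ys x lam) => p; rewrite !mulmxBr.
by congr col_mx; apply/matrixP => i j; rewrite !mxE; ring.
Qed.

Lemma x_step_fin_num x y lam : phi (x_step x y lam) \is a fin_num.
Proof.
by have [] := prox_subdiff (x - alpha *: (grad g x + K *m y + A^T *m lam))
  alpha0 (phi_proper Hst) (phi_lsc Hst) (phi_convex Hst).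
Qed.

(** The subgradient inequality for phi at the proximal point contributes
    -|dx|^2/alpha, the explicit lambda step contributes -|dlambda|^2/alpha, and
    [theta_upper] gives back Ltheta |d|^2.  The inexact y enters only through
    the difference between the direction of the step and the gradient of
    theta, which is (K w, B w). *)
Lemma theta_phi_step_le x y lam : phi x \is a fin_num ->
  let dx := x_step x y lam - x in let dl := lam_step x y lam - lam in
  let w := y - ys x lam in
  fine (phi (x_step x y lam)) + th (x_step x y lam) (lam_step x y lam)
    + (alpha^-1 - Ltheta K A B Lg mu) * (enorm dx ^+ 2 + enorm dl ^+ 2)
  <= fine (phi x) + th x lam
     + (opnorm K * enorm dx + opnorm B * enorm dl) * enorm w.
Proof.
move=> phix; cbv zeta; set dx := x_step x y lam - x.
set dl := lam_step x y lam - lam; set w := y - ys x lam.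
have [_ sub] := prox_subdiff (x - alpha *: (grad g x + K *m y + A^T *m lam))
  alpha0 (phi_proper Hst) (phi_lsc Hst) (phi_convex Hst).
have {sub} : fine (phi (x_step x y lam)) +
    dotv (alpha^-1 *: (x - alpha *: (grad g x + K *m y + A^T *m lam)
      - x_step x y lam)) (x - x_step x y lam) <= fine (phi x).
  by rewrite -lee_fin EFinD !fineK ?x_step_fin_num //; exact: sub.
have := theta_upper K A B c Hst x lam dx dl.
rewrite (addrC x dx) (addrC lam dl) /dx /dl !subrK (theta_grad_shift x lam y) -/w.
rewrite -/dx -/dl.
set v := grad g x + K *m y + A^T *m lam; set r := A *m x + B *m y + c.
have rE : dotv r dl = - (alpha^-1 * enorm dl ^+ 2).
  have dlE : dl = - (alpha *: r) by rewrite /dl /lam_step addrC addKr.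
  rewrite dlE enormN enormZ exprMn real_normK ?num_real // dotvNr dotvZr.
  by rewrite sqr_enorm; field; rewrite gt_eqF.
have vE : dotv (alpha^-1 *: (x - alpha *: v - x_step x y lam)) (x - x_step x y lam)
    = alpha^-1 * enorm dx ^+ 2 + dotv v dx.
  have -> : x - x_step x y lam = - dx by rewrite /dx opprB.
  have -> : x - alpha *: v - x_step x y lam = - (dx + alpha *: v).
    by rewrite /dx; apply/matrixP => i j; rewrite !mxE; ring.
  rewrite dotvZl dotvNl dotvNr opprK dotvDl dotvZl -sqr_enorm.
  by field; rewrite gt_eqF.
rewrite vE dotv_col_mx 2!dotvBl rE.
have Kw : - dotv (K *m w) dx <= opnorm K * enorm w * enorm dx.
  rewrite -dotvNr -(enormN dx); apply: le_trans (dotv_le_enorm _ _) _.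
  by rewrite ler_wpM2r ?enorm_ge0 ?enorm_mulmx_le.
have Bw : - dotv (B *m w) dl <= opnorm B * enorm w * enorm dl.
  rewrite -dotvNr -(enormN dl); apply: le_trans (dotv_le_enorm _ _) _.
  by rewrite ler_wpM2r ?enorm_ge0 ?enorm_mulmx_le.
move: Kw Bw.
move: (dotv (K *m w) dx) (dotv (B *m w) dl) (dotv v dx) => k b vd.
move: (enorm w) (enorm dx) (enorm dl) => ew ex el.
move: (fine _) (fine _) (th _ _) (th _ _) => f1 f2 t1 t2.
move=> *; lra.
Qed.

(** Replacing the exact gradient in Gtheta by the direction that the algorithm
    uses turns the proximal point into the next iterate, at the price of the
    gradient error. *)
Lemma Gtheta_le x y lam :
  enorm (Gtheta K A B c g h psi (fun x' _ => phi x') alpha^-1 x lam) <=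
  alpha^-1 * (enorm (x_step x y lam - x) + enorm (lam_step x y lam - lam))
  + (opnorm K + opnorm B) * enorm (y - ys x lam).
Proof.
rewrite /Gtheta invrK (grad_theta K A B c Hst).
rewrite (prox_usubmx _ alpha0 (phi_proper Hst) (phi_lsc Hst) (phi_convex Hst)).
rewrite (theta_grad_shift x lam y); set w := y - ys x lam.
set v := grad g x + K *m y + A^T *m lam; set r := A *m x + B *m y + c.
rewrite scale_col_mx !opp_col_mx !add_col_mx col_mxKu col_mxKd.
set p := prox _ _ _.
rewrite enormZ gtr0_norm ?invr_gt0 // -ler_pdivlMl ?invr_gt0 // invrK.
apply: le_trans (enorm_col_mx_le _ _) _.
rewrite mulrDr mulrA divff ?gt_eqF // mul1r.
have xp : enorm (x - p) <=
    enorm (x_step x y lam - x) + alpha * (opnorm K * enorm w).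
  have -> : x - p = (x - x_step x y lam) + (x_step x y lam - p).
    by rewrite subrKA.
  apply: le_trans (ler_enormD _ _) _; apply: lerD; first by rewrite enormBC.
  apply: le_trans (prox_nonexpansive (x - alpha *: v) (x - alpha *: (v - K *m w))
    alpha0 (phi_proper Hst) (phi_lsc Hst) (phi_convex Hst)) _.
  have -> : x - alpha *: v - (x - alpha *: (v - K *m w)) = - (alpha *: (K *m w)).
    by apply/matrixP => i j; rewrite !mxE; ring.
  by rewrite enormN enormZ gtr0_norm // ler_pM2l // enorm_mulmx_le.
have lp : enorm (lam - (lam - alpha *: (r - B *m w))) <=
    enorm (lam_step x y lam - lam) + alpha * (opnorm B * enorm w).
  have -> : lam - (lam - alpha *: (r - B *m w)) =
      - (lam_step x y lam - lam) - alpha *: (B *m w).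
    by rewrite /lam_step; apply/matrixP => i j; rewrite !mxE; ring.
  apply: le_trans (ler_enormB _ _) _; rewrite enormN lerD2l.
  by rewrite enormZ gtr0_norm // ler_pM2l // enorm_mulmx_le.
move: xp lp; rewrite mulrA; move: (enorm _) (enorm _) (enorm _) (enorm _) => *; lra.
Qed.

Definition primal_residual x y lam := x_step x y lam - x.

Let weighted_le (a b d u v w : R) : 0 <= a -> 0 <= b -> 0 <= d ->
  0 <= u -> 0 <= v -> 0 <= w -> a * u + b * v + d * w <= (a + b + d) * (u + v + w).
Proof. by move=> *; nra. Qed.

Lemma primal_residual_lipschitz : exists C, jointly_lipschitz C primal_residual.
Proof.
exists (2 + alpha * Lg + alpha * opnorm K + alpha * opnorm A^T).
move=> x y l x' y' l'; rewrite /primal_residual.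
have Lg0 := ltW (Lg_gt0 Hst).
apply: le_trans (weighted_le _ _ _ (enorm_ge0 _) (enorm_ge0 _) (enorm_ge0 _));
  rewrite ?addr_ge0 ?mulr_ge0 ?opnorm_ge0 ?(ltW alpha0) //.
rewrite subr_swap.
apply: le_trans (ler_enormB _ _) _.
have step := prox_nonexpansive (x - alpha *: (grad g x + K *m y + A^T *m l))
  (x' - alpha *: (grad g x' + K *m y' + A^T *m l'))
  alpha0 (phi_proper Hst) (phi_lsc Hst) (phi_convex Hst).
apply: (@le_trans _ _ (enorm (x - x') + alpha * (Lg * enorm (x - x')
   + opnorm K * enorm (y - y') + opnorm A^T * enorm (l - l')) + enorm (x - x')));
  last by move: (enorm _) (enorm _) (enorm _) => *; lra.
rewrite lerD2r; apply: le_trans step _.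
rewrite [X in enorm X](_ : _ = (x - x') - alpha *: ((grad g x - grad g x')
    + K *m (y - y') + A^T *m (l - l'))); last first.
  by rewrite !mulmxBr; apply/matrixP => i j; rewrite !mxE; ring.
apply: le_trans (ler_enormB _ _) _; rewrite lerD2l enormZ gtr0_norm // ler_pM2l //.
apply: le_trans (ler_enormD _ _) _; apply: lerD; last exact: enorm_mulmx_le.
apply: le_trans (ler_enormD _ _) _; apply: lerD; last exact: enorm_mulmx_le.
exact: (g_lip Hst).
Qed.

Let Gf1E x y lam : Gf K B h psi 1 x y lam =
  y - prox 1 psi (y + (- grad h y + K^T *m x + B^T *m lam)).
Proof. by rewrite /Gf scale1r invr1 scale1r. Qed.

Lemma Gf_lipschitz : exists C, jointly_lipschitz C (Gf K B h psi 1).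
Proof.
exists (opnorm K^T + (2 + Lh) + opnorm B^T).
move=> x y l x' y' l'; rewrite !Gf1E.
have Lh0 := ltW (Lh_gt0 Hst).
apply: le_trans (weighted_le _ _ _ (enorm_ge0 _) (enorm_ge0 _) (enorm_ge0 _));
  rewrite ?addr_ge0 ?opnorm_ge0 //.
set z := y + (_ + _ + _); set z' := y' + (_ + _ + _).
have step := prox_nonexpansive z z' ltr01 (psi_proper Hst) (psi_lsc Hst) (psi_convex Hst).
rewrite subr_swap.
have zE : z - z' = (y - y') + (- (grad h y - grad h y')
    + K^T *m (x - x') + B^T *m (l - l')).
  rewrite /z /z' !mulmxBr; move: (grad h y) (grad h y') (K^T *m _) (K^T *m _).
  move: (B^T *m _) (B^T *m _) => *.
  by apply/matrixP => i j; rewrite !mxE; ring.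
apply: le_trans (ler_enormB _ _) _.
apply: (@le_trans _ _ (enorm (y - y') + (enorm (y - y') + (Lh * enorm (y - y')
   + opnorm K^T * enorm (x - x') + opnorm B^T * enorm (l - l')))));
  last by move: (enorm _) (enorm _) (enorm _) => *; lra.
apply: lerD; first exact: lexx.
apply: le_trans step _; rewrite zE.
apply: le_trans (ler_enormD _ _) _; rewrite lerD2l.
apply: le_trans (ler_enormD _ _) _; apply: lerD; last exact: enorm_mulmx_le.
apply: le_trans (ler_enormD _ _) _; apply: lerD; last exact: enorm_mulmx_le.
by rewrite enormN; exact: (h_lip Hst).
Qed.

Lemma constraint_lipschitz :
  exists C, jointly_lipschitz C (fun x y (_ : 'cV[R]_q) => A *m x + B *m y + c).
Proof.
exists (opnorm A + opnorm B + 0) => x y l x' y' l'.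
apply: le_trans (weighted_le _ _ _ (enorm_ge0 _) (enorm_ge0 _) (enorm_ge0 _));
  rewrite ?opnorm_ge0 // mul0r addr0.
have -> : A *m x + B *m y + c - (A *m x' + B *m y' + c) =
    A *m (x - x') + B *m (y - y').
  by rewrite !mulmxBr; apply/matrixP => i j; rewrite !mxE; ring.
by apply: le_trans (ler_enormD _ _) _; apply: lerD; exact: enorm_mulmx_le.
Qed.

(** A fixed point of a proximal gradient step satisfies the inclusion, by
    [prox_subdiff]; this is applied to phi with step alpha and to psi with
    step 1. *)
Lemma stationary_of_residuals x y lam :
  primal_residual x y lam = 0 -> Gf K B h psi 1 x y lam = 0 ->
  A *m x + B *m y + c = 0 -> stationary_point K A B c g h phi psi x y lam.
Proof.
rewrite Gf1E /primal_residual /x_step.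
move=> /subr0_eq xE /subr0_eq yE feas; split=> //.
  exists (- (grad g x + K *m y + A^T *m lam)); last first.
    by apply/matrixP => i j; rewrite !mxE; ring.
  have [_] := prox_subdiff (x - alpha *: (grad g x + K *m y + A^T *m lam))
    alpha0 (phi_proper Hst) (phi_lsc Hst) (phi_convex Hst).
  rewrite xE; move: (grad g x + _ + _) => v.
  by rewrite addrAC subrr add0r scalerN scalerA mulVf ?gt_eqF // scale1r.
exists (- grad h y + K^T *m x + B^T *m lam); last first.
  by apply/matrixP => i j; rewrite !mxE; ring.
have [_] := prox_subdiff (y + (- grad h y + K^T *m x + B^T *m lam))
  ltr01 (psi_proper Hst) (psi_lsc Hst) (psi_convex Hst).
rewrite -yE; move: (- grad h y + _ + _) => v.
by rewrite addrAC subrr add0r invr1 scale1r.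
Qed.

End OneStep.
(** * The convergence theorem *)

Lemma young_error (R : realType) (kappa k l u v w : R) : 0 < kappa ->
  (k * u + l * v) * w <=
  kappa / 2 * (u ^+ 2 + v ^+ 2) + (k ^+ 2 + l ^+ 2) / (2 * kappa) * w ^+ 2.
Proof.
move=> kappa0; rewrite -subr_ge0.
have -> : kappa / 2 * (u ^+ 2 + v ^+ 2) + (k ^+ 2 + l ^+ 2) / (2 * kappa) * w ^+ 2
    - (k * u + l * v) * w =
    ((kappa * u - k * w) ^+ 2 + (kappa * v - l * w) ^+ 2) / (2 * kappa).
  by field; rewrite gt_eqF.
by rewrite divr_ge0 ?addr_ge0 ?sqr_ge0 // mulr_ge0 // ltW.
Qed.

Theorem proposition4p1 (R : realType) (n m q : nat)
  (K : 'M[R]_(n, m)) (A : 'M[R]_(q, n)) (B : 'M[R]_(q, m)) (c : 'cV[R]_q)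
  (g : 'cV[R]_n -> R) (h : 'cV[R]_m -> R)
  (phi : 'cV[R]_n -> \bar R) (psi : 'cV[R]_m -> \bar R)
  (Lg Lh mu : R)
  (Hstanding : standing_hypotheses g h phi psi Lg Lh mu)
  (Hinf : (-oo < ereal_inf [set theta_phi K A B c g h phi psi p.1 p.2
                            | p in [set: 'cV[R]_n * 'cV[R]_q]])%E)
  (alpha : R) (Halpha : 0 < alpha < 1 / Ltheta K A B Lg mu)
  (eps : nat -> R) (Heps : forall t, 0 < eps t)
  (x : nat -> 'cV[R]_n) (y : nat -> 'cV[R]_m) (lam : nat -> 'cV[R]_q)
  (Halg : alternating_coordinate K A B c g h phi psi alpha eps x y lam)
  (rho0 : R) (Hrho0 : 0 < rho0)
  (Herr : forall (t : nat) (v : 'cV[R]_m),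
    enorm (v - ystar K A B c h psi (x t) (lam t))
      <= enorm (y t - ystar K A B c h psi (x t) (lam t)) ->
    enorm (v - ystar K A B c h psi (x t) (lam t))
      <= rho0 * enorm (Gf K B h psi 1 (x t) v (lam t)))
  (Hdecr : forall t : nat,
    enorm (y t.+1 - ystar K A B c h psi (x t) (lam t))
      <= enorm (y t - ystar K A B c h psi (x t) (lam t)))
  (Hsum : (\sum_(0 <= t <oo) (eps t ^+ 2)%:E < +oo)%E) :
  [/\ (\sum_(0 <= t <oo)
         (enorm (col_mx (x t.+1) (lam t.+1) - col_mx (x t) (lam t)) ^+ 2)%:E
       < +oo)%E,
      Gtheta K A B c g h psi (fun x' _ => phi x') alpha^-1 (x t) (lam t)
        @[t --> \oo] --> (0 : 'cV[R]_(n + q))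
      /\ Gf K B h psi 1 (x t) (y t) (lam t)
           @[t --> \oo] --> (0 : 'cV[R]_m)
    & forall (xb : 'cV[R]_n) (yb : 'cV[R]_m) (lamb : 'cV[R]_q),
        cluster ((fun t => (x t, y t, lam t)) @ \oo) (xb, yb, lamb) ->
        stationary_point K A B c g h phi psi xb yb lamb].
Proof.
case/andP: Halpha => alpha0 alphaL; have [acy acx acl] := Halg.
set L := Ltheta K A B Lg mu in alphaL.
have kappa0 : 0 < alpha^-1 - L.
  (* L = 0 would make 1 / L = 0, leaving no room for alpha. *)
  have LN0 : L != 0.
    apply/eqP => LE; move: alphaL; rewrite LE invr0 mulr0 => /(lt_trans alpha0).
    by rewrite ltxx.
  have L0 : 0 < L by rewrite lt_neqAle eq_sym LN0 Ltheta_ge0 // (mu_gt0 Hstanding).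
  by rewrite subr_gt0 -[alpha^-1]mul1r ltr_pdivlMr // mulrC -ltr_pdivlMr.
set kappa := alpha^-1 - L in kappa0.
pose w t := y t.+1 - ystar K A B c h psi (x t) (lam t).
have w_le t : enorm (w t) <= rho0 * eps t.
  apply: le_trans (Herr t (y t.+1) (Hdecr t)) _.
  by rewrite ler_pM2l //; exact: acy.
pose s t := enorm (x t.+1 - x t) ^+ 2 + enorm (lam t.+1 - lam t) ^+ 2.
have s0 t : 0 <= s t by rewrite addr_ge0 ?sqr_ge0.
have sE t : enorm (col_mx (x t.+1) (lam t.+1) - col_mx (x t) (lam t)) ^+ 2 = s t.
  by rewrite opp_col_mx add_col_mx sqr_enorm_col_mx.
have phi_fin t : phi (x t.+1) \is a fin_num.
  by rewrite acx; exact: (x_step_fin_num K A Hstanding alpha0).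
pose V t := fine (phi (x t)) + theta K A B c g h psi (x t) (lam t).
have [b Vb] : exists b, forall t, b <= V t.+1.
  have [b bI] : exists b : R, (b%:E <= ereal_inf [set theta_phi K A B c g h phi psi
      p.1 p.2 | p in [set: 'cV[R]_n * 'cV[R]_q]])%E.
    move: Hinf; case: (ereal_inf _) => [r| |] // _; first by exists r.
    by exists 0; rewrite leey.
  exists b => t; rewrite -lee_fin; apply: le_trans bI _; apply: ge_ereal_inf.
  exists (theta_phi K A B c g h phi psi (x t.+1) (lam t.+1)).
    by exists (x t.+1, lam t.+1).
  by rewrite /theta_phi /V -[X in (X + _)%E](fineK (phi_fin t)) -EFinD.
set k := opnorm K; set l := opnorm B.
(* The part of Young's inequality that kappa/2 |z^{t+1} - z^t|^2 does not
   absorb, with |w| <= rho0 * eps. *)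
set d := (k ^+ 2 + l ^+ 2) / (2 * kappa) * rho0 ^+ 2.
have d0 : 0 <= d.
  apply: mulr_ge0; last exact: sqr_ge0.
  by rewrite divr_ge0 ?addr_ge0 ?sqr_ge0 // mulr_ge0 // ltW.
pose e t := d * eps t ^+ 2.
have e0 t : 0 <= e t by rewrite mulr_ge0 // sqr_ge0.
have esum : (\sum_(0 <= t <oo) (e t)%:E < +oo)%E.
  apply/(nneseries_ltyP e0).
  have /nneseries_ltyP [|M epsM] := Hsum; first by move=> t; exact: sqr_ge0.
  by exists (d * M) => N; rewrite /e -mulr_sumr ler_wpM2l.
have descent t : V t.+2 + kappa / 2 * s t.+1 <= V t.+1 + e t.+1.
  have := theta_phi_step_le K A B c Hstanding alpha0 (y t.+2) (lam t.+1) (phi_fin t).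
  rewrite /x_step /lam_step -acx -acl -/(w t.+1) -/(V t.+1) -/(V t.+2) -/L -/kappa.
  rewrite -/k -/l -/(s t.+1) => step.
  have := young_error k l (enorm (x t.+2 - x t.+1)) (enorm (lam t.+2 - lam t.+1))
    (enorm (w t.+1)) kappa0.
  rewrite -/(s t.+1) => young.
  have : (k ^+ 2 + l ^+ 2) / (2 * kappa) * enorm (w t.+1) ^+ 2 <= e t.+1.
    rewrite /e /d -[leRHS]mulrA -exprMn ler_wpM2l //.
      by rewrite divr_ge0 ?addr_ge0 ?sqr_ge0 // mulr_ge0 // ltW.
    by rewrite lerXn2r ?nnegrE ?enorm_ge0 // mulr_ge0 // ltW.
  lra.
have ssum : (\sum_(0 <= t <oo) (s t)%:E < +oo)%E.
  have kappa20 : 0 < kappa / 2 by rewrite divr_gt0.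
  exact: (summable_of_descent kappa20 s0 e0 Vb descent esum).
have s_cvg0 : s @ \oo --> 0 by exact: summable_cvg0.
have dx0 : enorm (x t.+1 - x t) @[t --> \oo] --> 0.
  apply: sqr_cvg0 => [t|]; first exact: enorm_ge0.
  apply: squeeze_cvgr (cvg_cst 0) s_cvg0; apply: nearW => t.
  by rewrite sqr_ge0 /s lerDl sqr_ge0.
have dl0 : enorm (lam t.+1 - lam t) @[t --> \oo] --> 0.
  apply: sqr_cvg0 => [t|]; first exact: enorm_ge0.
  apply: squeeze_cvgr (cvg_cst 0) s_cvg0; apply: nearW => t.
  by rewrite sqr_ge0 /s lerDr sqr_ge0.
have eps0 : eps @ \oo --> 0.
  apply: sqr_cvg0 => [t|]; first exact: ltW.
  by apply: summable_cvg0 => // t; exact: sqr_ge0.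
have G0 : enorm (Gf K B h psi 1 (x t) (y t) (lam t)) @[t --> \oo] --> 0.
  have [C lipG] := Gf_lipschitz K B Hstanding.
  apply: residual_cvg0 lipG dx0 dl0 _.
  apply: squeeze_cvgr (cvg_cst 0) eps0; apply: nearW => t.
  by rewrite enorm_ge0 acy.
have feas0 : enorm (A *m x t + B *m y t + c) @[t --> \oo] --> 0.
  have [C lipG] := constraint_lipschitz A B c.
  apply: (residual_cvg0 (lam := lam) lipG dx0 dl0).
  have -> : (fun t => enorm (A *m x t + B *m y t.+1 + c)) =
      fun t => alpha^-1 * enorm (lam t.+1 - lam t).
    apply/funext => t.
    have -> : lam t.+1 - lam t = - (alpha *: (A *m x t + B *m y t.+1 + c)).
      by rewrite acl addrAC subrr add0r.
    rewrite enormN enormZ gtr0_norm //.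
    by rewrite mulrA mulVf ?mul1r // gt_eqF.
  by rewrite -[X in _ --> X](mulr0 alpha^-1); exact: cvgMr.
have primal0 : enorm (primal_residual K A g phi alpha (x t) (y t) (lam t))
    @[t --> \oo] --> 0.
  have [C lipG] := primal_residual_lipschitz K A Hstanding alpha0.
  apply: (residual_cvg0 lipG dx0 dl0).
  by under eq_fun do rewrite /primal_residual /x_step -acx.
split.
- by under eq_eseriesr do rewrite sE.
- split; last by apply: cvg_enorm0 G0.
  apply: cvg_enorm0 => [t|].
    exact: (Gtheta_le K A B c Hstanding alpha0 (x t) (y t.+1) (lam t)).
  rewrite -[X in _ --> X]addr0; apply: cvgD.
    rewrite -[X in _ --> X](mulr0 alpha^-1); apply: cvgMr.
    rewrite -[X in _ --> X]addr0; apply: cvgD.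
      by under eq_fun do rewrite /x_step -acx.
    by under eq_fun do rewrite /lam_step -acl.
  rewrite -[X in _ --> X](mulr0 (opnorm K + opnorm B)); apply: cvgMr.
  apply: (squeeze_cvgr (f := fun=> 0) (h := fun t => rho0 * eps t)).
  - by apply: nearW => t; rewrite enorm_ge0 w_le.
  - exact: cvg_cst.
  - by rewrite -[X in _ --> X](mulr0 rho0); exact: cvgMr.
move=> xb yb lamb clu; apply: (stationary_of_residuals Hstanding alpha0).
- have [C lipG] := primal_residual_lipschitz K A Hstanding alpha0.
  exact: cluster_zero lipG primal0 clu.
- have [C lipG] := Gf_lipschitz K B Hstanding.
  exact: cluster_zero lipG G0 clu.
- have [C lipG] := constraint_lipschitz A B c.
  exact: cluster_zero lipG feas0 clu.
Qed.
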